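(* Let $\theta>0$ and, for $x>0$, let $X(t)=x-N_t$, where $N_t$ is a homogeneous Poisson process with intensity $\theta$ and $N_0=0$. Let $\tau(x)=\inf\{t>0: X(t)\le 0\}$ and $A(x)=\int_0^{\tau(x)}X(t)\,dt$. For integers $m,n\ge 0$ put $V_{m,n}(x)=E[\tau(x)^mA(x)^n]$. Then for all integers $m,n\ge 0$ with $(m,n)\ne(0,0)$, $V_{m,n}$ is the solution of the following problem, i.e. it satisfies $$\theta\,[V_{m,n}(x-1)-V_{m,n}(x)]=-n\,x\,V_{m,n-1}(x)-m\,V_{m-1,n}(x)\quad\text{for all }x>0,$$ $$V_{m,n}(y)=0\quad\text{for all }y\le 0,$$ and, for each fixed $x$, $\lim_{\theta\to+\infty}V_{m,n}(x)=0$ (with $V_{m,n}(x)$ regarded as a function of the intensity $\theta$).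
   Context: For a starting point $y\le 0$ the convention is $\tau(y)=0$ and $A(y)=0$. $V_{0,0}(x)=1$ for $x>0$. A term on the right-hand side whose coefficient $n$ or $m$ is zero is understood to be $0$. *)

(* Defs.v *)
From mathcomp Require Import all_boot all_order all_algebra.
From mathcomp Require Import all_classical all_reals all_analysis.

Set Implicit Arguments.
Unset Strict Implicit.
Unset Printing Implicit Defensive.

Import Order.TTheory GRing.Theory Num.Theory.
Import numFieldNormedType.Exports.

Local Open Scope classical_set_scope.
Local Open Scope ring_scope.

(* Sets B i = setT are allowed, so the product rule for the whole finite family
   contains the product rule for each of its subfamilies. *)
Definition independent_rvs (R : realType) (d d' : measure_display)
    (T : measurableType d) (T' : measurableType d') (P : probability T R)
    (I : finType) (Y : I -> T -> T') : Prop :=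
  forall B : I -> set T', (forall i, measurable (B i)) ->
    P [set w | forall i, B i (Y i w)] =
    (\prod_(i : I) P [set w | B i (Y i w)])%E.

(* The time set is [0, +oo[; the values N t for t < 0 are irrelevant. The
   subtraction of nat used for the increments is never truncated, since the
   paths are nondecreasing. *)
Record poisson_process (R : realType) (d : measure_display)
    (T : measurableType d) (P : probability T R) (theta : R)
    (N : R -> T -> nat) : Prop := PoissonProcess {
  poisson_process_measurable :
    forall t, 0 <= t -> measurable_fun setT (N t) ;
  poisson_process_start : forall w, N 0 w = 0%N ;
  poisson_process_nondecreasing :
    forall w s t, 0 <= s -> s <= t -> (N s w <= N t w)%N ;
  poisson_process_right_continuous :
    forall w t, 0 <= t -> \forall s \near t^'+, N s w = N t w ;
  poisson_process_increments :
    forall s t, 0 <= s -> s < t -> forall k : nat,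
      P [set w | (N t w - N s w)%N = k] =
      (poisson_pmf (theta * (t - s)) k)%:E ;
  poisson_process_independent_increments :
    forall (n : nat) (t : nat -> R),
      0 <= t 0%N -> (forall i, t i <= t i.+1) ->
      independent_rvs P (fun (i : 'I_n) w => (N (t i.+1) w - N (t i) w)%N)
}.

Section first_passage.
Variables (R : realType) (d : measure_display) (T : measurableType d).
Variable N : R -> T -> nat.

Definition walk (x t : R) (w : T) : R := x - (N t w)%:R.

(* Extended-real valued: the value is +oo on the (null) event that the level 0
   is never reached. *)
Definition passage_time (x : R) (w : T) : \bar R :=
  if x <= 0 then 0%E
  else ereal_inf [set t%:E | t in [set t | 0 < t /\ walk x t w <= 0]].

Definition passage_area (x : R) (w : T) : \bar R :=
  if x <= 0 then 0%E
  else (\int[lebesgue_measure]_(t in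
          [set t : R | (0 <= t)%R /\ (t%:E <= passage_time x w)%E])
          (walk x t w)%:E)%E.

Definition joint_moment (P : probability T R) (m n : nat) (x : R) : \bar R :=
  (\int[P]_w (passage_time x w ^+ m * passage_area x w ^+ n))%E.

End first_passage.

(* Main.v *)
Require Import Defs.
From mathcomp Require Import all_boot all_order all_algebra.
From mathcomp Require Import all_classical all_reals all_analysis.
From mathcomp Require Import measurable_realfun ring lra.
Import Order.TTheory GRing.Theory Num.Theory.
Import numFieldNormedType.Exports.
Local Open Scope classical_set_scope.
Local Open Scope ring_scope.

Set Implicit Arguments.
Unset Strict Implicit.
Unset Printing Implicit Defensive.

(** Write x = k + al with 0 < al <= 1, and let s_i be the time of the i-th jump.
    Then tau(x) = s_(k+1) and, summing by layers, A(x) = s_1 + .. + s_k + al s_(k+1).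
    Fix a small time h and condition on N_h. Under P( . | N_h in B) the process
    N' t = N (h + t) - N h is again Poisson, and with a', b' the values of tau
    and A computed from N' we have tau(x) = h + a'(x), A(x) = x h + b'(x) if
    N_h = 0, and tau(x) = a'(x - 1) + O(h), A(x) = b'(x - 1) + O(h) if N_h = 1.
    With e = exp (- theta h) this gives, up to O(h^2) uniformly over all Poisson
    processes,
      V_{m,n}(x) = e (V'_{m,n}(x) + h (m V'_{m-1,n}(x) + n x V'_{m,n-1}(x)))
                   + theta h e V'_{m,n}(x - 1).
    The primed moments belong to other Poisson processes under other
    probabilities on the same space, so nothing is known about them at first. By
    induction the lower order ones do not depend on the process; if c is the
    value of V_{m,n}(x) predicted by the recursion and D is the supremum of
    |V_{m,n}(x) - c| over all Poisson processes, then D <= e D + O(h^2), so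
    D = 0. This yields the recursion and the independence of the process at
    the same time, without any strong Markov property. *)

(** * Layers of the walk and half-open time intervals *)

Lemma sum_leq_ord (n k : nat) : (\sum_(i < k) (n <= i) = k - n)%N.
Proof.
elim: k => [|k IHk]; first by rewrite big_ord0.
rewrite big_ord_recr/= IHk; case: leqP => [nk|kn].
  by rewrite subSn// addn1.
by rewrite addn0 (eqP (ltnW kn)) (eqP kn).
Qed.

Section half_open.
Context {R : realType}.

(** Open on the right so that, for the passage time to level [i.+1], membership of [t] amounts to
    [N t w <= i]. The endpoint is extended because a passage time may be infinite. *)
Definition before (e : \bar R) : set R := [set t | 0 <= t /\ (t%:E < e)%E].

Lemma before_fin (r : R) : before r%:E = `[0, r[%classic.
Proof.
apply/seteqP; split => t; rewrite /before/= in_itv/= lte_fin.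
  by move=> [-> ->].
by move=> /andP[].
Qed.

Lemma before_pinfty : before +oo = `[0, +oo[%classic.
Proof.
apply/seteqP; split => t; rewrite /before/= in_itv/= andbT ?ltry//.
by move=> [].
Qed.

Lemma measurable_before {e : \bar R} : (0 <= e)%E -> measurable (before e).
Proof. by case: e => [r||]// _; rewrite ?before_fin ?before_pinfty. Qed.

Lemma lebesgue_before {e : \bar R} : (0 <= e)%E ->
  lebesgue_measure (before e) = e.
Proof.
case: e => [r||]//; rewrite ?lee_fin => r0.
  rewrite before_fin lebesgue_measure_itv/= lte_fin.
  case: ltP => [_|rle0]; first by rewrite oppr0 adde0.
  by congr EFin; apply/eqP; rewrite eq_le r0.
by rewrite before_pinfty lebesgue_measure_itv/= ltry oppr0 addeC.
Qed.

End half_open.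

(** * Passage times and areas along a single path *)

Section passage_paths.
Context (R : realType) (d : measure_display) (T : measurableType d).
Variables (P : probability T R) (theta : R) (N : R -> T -> nat).
Hypothesis HN : poisson_process P theta N.

Lemma passage_time_ge0 x w : (0 <= passage_time N x w)%E.
Proof.
rewrite /passage_time; case: ifPn => // _.
by apply: le_ereal_inf_tmp => _ [t [t0 _] <-]; rewrite lee_fin ltW.
Qed.

(** Right-continuity makes the infimum a minimum: if [N t w < x], the path stays constant on some
    [[t, t + e[], so no crossing occurs before [t + e]. Conversely, if [x <= N t w] then [t] is
    itself a crossing time, positive because the path starts at 0, below [x]. *)
Lemma passage_time_le x t w : 0 < x -> 0 <= t ->
  (passage_time N x w <= t%:E)%E = (x <= (N t w)%:R).
Proof.
move=> x0 t0; rewrite /passage_time (lt_geF x0).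
apply/idP/idP => [|xN]; last first.
  apply: ereal_inf_lbound; exists t => //=; split; last by rewrite /walk subr_le0.
  rewrite lt_neqAle t0 andbT; apply/eqP => t0'.
  by move: xN; rewrite -t0' (poisson_process_start HN) leNgt x0.
apply: contraTT; rewrite -!ltNge => Nx.
have /nbhs_ballP[e /= e0 He] := poisson_process_right_continuous HN w t0.
apply: (@lt_le_trans _ _ (t + e)%:E); first by rewrite lte_fin ltrDl.
apply: le_ereal_inf_tmp => y [s [s0]]; rewrite /walk subr_le0 => xs <-.
rewrite lee_fin leNgt; apply/negP => ste.
suff : (N s w <= N t w)%N by rewrite -(ler_nat R) leNgt (lt_le_trans Nx).
have [st|ts] := leP s t.
  exact: (poisson_process_nondecreasing HN _ (ltW s0) st).
rewrite (He s)//= /ball/= distrC ger0_norm ?subr_ge0 ?ltW//.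
by rewrite ltrBlDl.
Qed.

Lemma measurable_passage_time x : measurable_fun setT (passage_time N x).
Proof.
have [x0|x0] := leP x 0.
  rewrite (_ : passage_time N x = cst 0%E) //.
  by apply/funext => w; rewrite /passage_time x0.
apply: (measurability _ (ErealGenOInfty.measurableE R)) => //.
move=> /= _ [_ [t ->]] <-; apply: measurableI => //.
have [t0|t0] := leP 0 t; last first.
  rewrite (_ : _ @^-1` _ = setT) //; apply/seteqP; split => w //= _.
  by rewrite in_itv/= andbT (lt_le_trans _ (passage_time_ge0 x w))// lte_fin.
rewrite (_ : _ @^-1` _ = N t @^-1` [set n | n%:R < x]); last first.
  by apply/seteqP; split => w /=; rewrite in_itv/= andbT (ltNge t%:E) passage_time_le// -ltNge.
rewrite -[X in measurable X]setTI.
exact: (poisson_process_measurable HN t0).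
Qed.

(** The path is integer valued, so it reaches [k + al] exactly when it reaches the next integer. *)
Lemma passage_time_ceil (k : nat) (al : R) w : 0 < al -> al <= 1 ->
  passage_time N (k%:R + al) w = passage_time N k.+1%:R w.
Proof.
move=> al0 al1; rewrite /passage_time.
have k0 : 0 <= k%:R :> R by [].
rewrite [_ <= 0]lt_geF ?ltr_wpDl// lern0/=; congr ereal_inf; congr image.
apply/seteqP; split => t [t0]; rewrite /walk/= !subr_le0 => h; split => //.
  rewrite ler_nat ltnNge; apply/negP; rewrite -(ler_nat R) leNgt.
  by rewrite (lt_le_trans _ h)// ltrDl.
by rewrite (le_trans _ h)// -natr1 lerD2l.
Qed.

(** Before the passage to [k.+1], the height [k + al - N t] is [al] plus the number of [i < k] with
    [N t <= i]. Layer [i] has unit thickness and lasts until the passage to [i.+1]; the top term is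
    a layer of thickness [al]. The identity is in the extended reals, so infinite passage times are
    covered. *)
Lemma passage_area_sum (k : nat) (al : R) w : 0 < al -> al <= 1 ->
  passage_area N (k%:R + al) w =
  (\sum_(i < k) passage_time N i.+1%:R w +
   al%:E * passage_time N k.+1%:R w)%E.
Proof.
move=> al0 al1; rewrite /passage_area.
have k0 : 0 <= k%:R :> R by [].
rewrite [_ <= 0]lt_geF ?ltr_wpDl// passage_time_ceil//.
pose S i := passage_time N i.+1%:R w; rewrite -/(S k).
have S0 i : (0 <= S i)%E by exact: passage_time_ge0.
have SN i t : 0 <= t -> (t%:E < S i)%E = (N t w <= i)%N.
  by move=> t0; rewrite ltNge passage_time_le// ler_nat -ltnNge ltnS.
have mS i := measurable_before (S0 i).
pose g t := \sum_(i < k) \1_(before (S i)) t + al * \1_(before (S k)) t.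
have mg : measurable_fun setT g.
  apply: measurable_funD; first by apply: measurable_sum => i; exact: measurable_indic.
  by apply: measurable_funM => //; exact: measurable_indic.
have wg t : before (S k) t -> walk N (k%:R + al) t w = g t.
  move=> [t0 tS]; rewrite /g /walk.
  have inS i : (t \in before (S i)) = (N t w <= i)%N.
    rewrite -(SN i t t0); apply/idP/idP; first by rewrite inE => -[].
    by move=> ?; rewrite inE.
  rewrite indicE inS -SN// tS mulr1 addrAC; congr (_ + _).
  under eq_bigr do rewrite indicE inS.
  rewrite -natr_sum sum_leq_ord natrB//.
  by rewrite -SN.
(* The area is an integral over a closed interval. Its right endpoint is a null set, and for an
   infinite passage time the two domains coincide. *)
transitivity (\int[lebesgue_measure]_(t in before (S k)) (g t)%:E)%E.
  have -> : (\int[lebesgue_measure]_(t in before (S k)) (g t)%:E =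
       \int[lebesgue_measure]_(t in before (S k)) (walk N (k%:R + al) t w)%:E)%E.
    by apply: eq_integral => t; rewrite inE => /wg ->.
  case: (S k) wg (S0 k) (mS k) => [r wg _ mr|wg _ _|]//.
  rewrite before_fin integral_itv_bndo_bndc.
    congr (integral _ _ _); apply/seteqP; split => t; rewrite /= in_itv/= lee_fin.
      by move=> [-> ->].
    by move=> /andP[].
  apply/measurable_EFinP; rewrite -before_fin.
  apply: (@eq_measurable_fun _ _ _ _ _ g) => [t|]; first by rewrite inE => /wg ->.
  exact: measurable_funTS.
rewrite /g; under eq_integral do rewrite EFinD EFinM -sumEFin.
have mi i D : measurable D ->
    measurable_fun D (fun t => (\1_(before (S i)) t : R)%:E).
  by move=> mD; apply/measurable_EFinP/measurable_funTS; exact: measurable_indic.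
rewrite (ge0_integralD lebesgue_measure (mS k))//; last 4 first.
- by move=> t _; apply: sume_ge0 => i _; rewrite lee_fin.
- by apply: emeasurable_sum => i; exact: mi (mS k).
- by move=> t _; rewrite mule_ge0// lee_fin// ltW.
- by apply: emeasurable_funM => //; exact: mi (mS k).
have Smono (i : 'I_k) : before (S i) `<=` before (S k).
  by move=> t [t0]; rewrite SN// => Nt; split => //; rewrite SN// (leq_trans Nt)// ltnW.
rewrite (ge0_integral_sum lebesgue_measure (mS k))//; last by move=> i; exact: mi (mS k).
rewrite (ge0_integralZl lebesgue_measure (mS k))//; last 2 first.
- exact: mi (mS k).
- by rewrite lee_fin ltW.
have int_before i : before (S i) `<=` before (S k) ->
    (\int[lebesgue_measure]_(t in before (S k)) (\1_(before (S i)) t)%:E = S i)%E.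
  move=> sub; rewrite integral_indic; [|exact: mS|exact: mS].
  by rewrite setIidl//; exact: lebesgue_before.
by congr (_ + _ * _)%E; [apply: eq_bigr => i _|]; rewrite int_before.
Qed.

End passage_paths.

(** * Real-valued arrival times on the event that every level is reached *)

Definition reach_all {R : realType} {d : measure_display}
    {T : measurableType d} (N : R -> T -> nat) : set T :=
  [set w | forall k, exists j : nat, (k <= N j%:R w)%N].

(** [fine] sends an infinite passage time to 0, so these times are faithful only on [reach_all].
    That event is tested at integer times to be a countable combination of measurable sets. *)
Definition arrival {R : realType} {d : measure_display}
    {T : measurableType d} (N : R -> T -> nat) (k : nat) (w : T) : R :=
  fine (passage_time N k%:R w).

Section arrival_theory.
Context (R : realType) (d : measure_display) (T : measurableType d).
Variables (P : probability T R) (theta : R) (N : R -> T -> nat).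
Hypothesis HN : poisson_process P theta N.

Lemma measurable_preimage_process t (B : set nat) : 0 <= t ->
  measurable [set w | B (N t w)].
Proof.
move=> t0; rewrite -[X in measurable X]setTI.
exact: (poisson_process_measurable HN t0).
Qed.

Lemma measurable_reach_all : measurable (reach_all N).
Proof.
rewrite (_ : reach_all N =
    \bigcap_(k : nat) \bigcup_(j : nat) [set w | (k <= N j%:R w)%N]); last first.
  apply/seteqP; split => w /= Dw.
    by move=> k _; have [j kj] := Dw k; exists j.
  by move=> k; have [j _ kj] := Dw k I; exists j.
apply: bigcap_measurable => // k _; apply: bigcup_measurable => j _.
exact: (@measurable_preimage_process _ [set n | (k <= n)%N]).
Qed.

Lemma measurable_arrival k : measurable_fun setT (arrival N k).
Proof. 
apply: measurableT_comp => //; exact: measurable_passage_time HN _.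
Qed.

Lemma arrival_ge0 k w : 0 <= arrival N k w.
Proof. by rewrite fine_ge0// passage_time_ge0. Qed.

Lemma arrival0 w : arrival N 0 w = 0.
Proof. by rewrite /arrival /passage_time lexx. Qed.

Lemma EFin_arrival k w : reach_all N w ->
  (arrival N k w)%:E = passage_time N k%:R w.
Proof.
move=> Dw; rewrite fineK//.
have [->|k0] := posnP k; first by rewrite /passage_time lexx.
have [j kj] := Dw k.
rewrite ge0_fin_numE ?passage_time_ge0// (@le_lt_trans _ _ j%:R%:E) ?ltry//.
by rewrite (passage_time_le HN) ?ltr0n// ler_nat.
Qed.

(** The duality between arrival times and counts, by which comparisons of arrival times become
    comparisons of path values. *)
Lemma arrival_le k t w : reach_all N w -> 0 <= t ->
  (arrival N k w <= t) = (k <= N t w)%N.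
Proof.
move=> Dw t0; have [->|k0] := posnP k; first by rewrite arrival0 t0.
rewrite -lee_fin EFin_arrival// (passage_time_le HN) ?ltr0n//.
by rewrite ler_nat.
Qed.

Lemma le_arrival w : reach_all N w -> {homo arrival N ^~ w : i j / (i <= j)%N >-> i <= j}.
Proof.
move=> Dw i j ij; rewrite arrival_le ?arrival_ge0//.
by rewrite (leq_trans ij)// -arrival_le ?arrival_ge0.
Qed.

End arrival_theory.

(** * Geometric tails, uniform over all Poisson processes *)

Lemma expX_le_expR {R : realType} (y : R) n : 0 <= y -> y ^+ n <= n`!%:R * expR y.
Proof.
move=> y0; case: n => [|n].
  by rewrite expr0 fact0 mul1r (le_trans _ (expR_ge1Dx y))// lerDl.
rewrite mulrC -ler_pdivrMr ?ltr0n ?fact_gt0//.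
by rewrite (le_trans _ (expR_ge1Dxn n y0))// lerDr.
Qed.

Lemma nneseries_le_geometric {R : realType} (u : nat -> \bar R) (C rho : R) :
  0 <= C -> 0 <= rho -> rho < 1 -> (forall j, 0 <= u j)%E ->
  (forall j, u j <= (C * rho ^+ j)%:E)%E ->
  (\sum_(0 <= j <oo) u j <= (C / (1 - rho))%:E)%E.
Proof.
move=> C0 rho0 rho1 u0 uC.
apply: lime_le; first by apply: is_cvg_nneseries => j _ _; exact: u0.
apply: nearW => n.
apply: (@le_trans _ _ (\sum_(0 <= j < n) (C * rho ^+ j)%:E)%E).
  by apply: lee_sum => j _; exact: uC.
rewrite sumEFin lee_fin -mulr_sumr ler_wpM2l// -[leRHS]mul1r ler_pdivlMr ?subr_gt0//.
rewrite mulrC big_mkord -opprB mulNr -subrX1 opprB lerBlDr lerDl.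
exact: exprn_ge0.
Qed.

Section tails.
Context (R : realType) (d : measure_display) (T : measurableType d).
Variables (theta : R).
Hypothesis theta0 : 0 < theta.

(** Half of the exponent [theta * j] is kept as geometric decay; the other half absorbs powers of
    [j]. *)
Let rho : R := expR (- (theta / 2)).

Lemma process_law (P : probability T R) (N : R -> T -> nat) t i :
  poisson_process P theta N -> 0 < t ->
  P [set w | N t w = i] = (poisson_pmf (theta * t) i)%:E.
Proof.
move=> HN t0.
rewrite -{2}[t]subr0 -(poisson_process_increments HN (lexx _) t0).
by congr (P _); apply/seteqP; split => w /=; rewrite (poisson_process_start HN) subn0.
Qed.

(** [C] is chosen before [P] and [N], which is what makes all later moment bounds uniform. Induction
    on [k] adds the single value [N j = k] to the event. The weight uses [j.+2] because an arrival
    in []j, j + 1]] satisfies [1 + s <= j + 2]. *)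
Lemma poisson_tail r k : exists2 C : R, 0 <= C &
  forall (P : probability T R) (N : R -> T -> nat), poisson_process P theta N ->
  forall j : nat, ((j.+2%:R ^+ r)%:E * P [set w | (N j%:R w < k)%N] <=
     (C * rho ^+ j)%:E)%E.
Proof.
elim: k => [|k [C C0 HC]].
  exists 0 => // P N _ j; rewrite mul0r.
  rewrite (_ : [set _ | _] = set0) ?measure0 ?mule0 ?lexx//.
  by apply/seteqP; split => w /=; rewrite ltn0.
(* [C1] serves [j = 0], where the probability is bounded by 1. [C2] serves [j > 0]: it comes from
   [expX_le_expR] at [y = theta * (j + 2) / 2] with exponent [r + k], the constant part of [y]
   giving the factor [expR theta]. *)
pose C1 := 2 ^+ r : R.
pose C2 := theta ^+ k * (r + k)`!%:R * (2 / theta) ^+ (r + k) * expR theta : R.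
have C10 : 0 <= C1 by exact: exprn_ge0.
have C20 : 0 <= C2 by rewrite !mulr_ge0 ?exprn_ge0 ?expR_ge0 ?divr_ge0 ?ltW.
exists (C + (C1 + C2)); first by rewrite !addr_ge0.
move=> P N HN j.
rewrite (_ : [set _ | _] = [set w | (N j%:R w < k)%N] `|` [set w | N j%:R w = k]); last first.
  apply/seteqP; split => w /=; last by move=> [/leqW|->].
  by rewrite ltnS leq_eqVlt => /orP[/eqP|]; [right|left].
rewrite measureU; last 3 first.
- exact: (measurable_preimage_process HN [set n | (n < k)%N]).
- exact: (measurable_preimage_process HN [set n | n = k]).
- by apply/seteqP; split => w //= [+ Nk]; rewrite Nk ltnn.
rewrite muleDr// ?fin_num_adde_defl ?fin_num_measure//; last first.
  exact: (measurable_preimage_process HN [set n | n = k]).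
rewrite mulrDl EFinD leeD//; first exact: HC.
have r0 m : 0 <= rho ^+ m by rewrite exprn_ge0// expR_ge0.
have [->|j0] := posnP j.
  rewrite expr0 mulr1 (@le_trans _ _ (C1%:E * 1%:E)%E)//.
    by rewrite lee_pmul2l// probability_le1//; exact: (measurable_preimage_process HN [set n | n = k]).
  by rewrite mule1 lee_fin lerDl.
rewrite [X in (_ * X)%E](_ : _ = (poisson_pmf (theta * j%:R) k)%:E); last first.
  by apply: (process_law k HN); rewrite ltr0n.
rewrite -EFinM lee_fin.
rewrite (@le_trans _ _ (C2 * rho ^+ j))//; last by rewrite ler_wpM2r// lerDr.
rewrite /poisson_pmf mulr_gt0 ?ltr0n//.
pose y : R := theta / 2 * j.+2%:R.
have y0 : 0 <= y by rewrite mulr_ge0// divr_ge0// ltW.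
have -> : C2 * rho ^+ j = theta ^+ k * (2 / theta) ^+ (r + k) *
    ((r + k)`!%:R * expR y) * expR (- (theta * j%:R)).
  have -> : rho ^+ j = expR (- (theta * j%:R) + (theta / 2 * j%:R)).
    rewrite -expRM_natr; congr expR.
    by field.
  have -> : y = theta + theta / 2 * j%:R.
    by rewrite /y -[j.+2]addn2 natrD mulrDr addrC divfK.
  by rewrite /C2 !expRD; ring.
rewrite [leLHS]mulrA ler_wpM2r ?expR_ge0//.
apply: (@le_trans _ _ (theta ^+ k * (2 / theta) ^+ (r + k) * y ^+ (r + k))); last first.
  by rewrite ler_wpM2l ?expX_le_expR// mulr_ge0// exprn_ge0// ?divr_ge0 ?ltW.
have -> : theta ^+ k * (2 / theta) ^+ (r + k) * y ^+ (r + k) =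
    theta ^+ k * j.+2%:R ^+ (r + k).
  rewrite -mulrA -exprMn; congr (_ * _ ^+ _).
  by rewrite /y; field; rewrite lt0r_neq0.
rewrite exprD exprMn [leRHS]mulrCA ler_wpM2l ?exprn_ge0//.
rewrite -mulrA ler_wpM2l ?exprn_ge0 ?(ltW theta0)//.
rewrite (@le_trans _ _ (j%:R ^+ k))//.
  by rewrite ler_piMr ?exprn_ge0// invf_le1 ?ler1n ?ltr0n fact_gt0.
by rewrite lerXn2r ?nnegrE// ler_nat ltnW.
Qed.

End tails.

(** * Almost sure arrival and uniform moment bounds *)

Section moments.
Context (R : realType) (d : measure_display) (T : measurableType d).
Variables (theta : R).
Hypothesis theta0 : 0 < theta.

(** The complement is a countable union over [k] of the events that [N j < k] for every [j]. Each
    lies inside every tail event of level [k], whose probabilities tend to 0. *)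
Lemma poisson_not_reach_all (P : probability T R) (N : R -> T -> nat) :
  poisson_process P theta N -> P (~` reach_all N) = 0%E.
Proof.
move=> HN.
rewrite (_ : ~` _ =
    \bigcup_(k : nat) \bigcap_(j : nat) [set w | (N j%:R w < k)%N]); last first.
  apply/seteqP; split => w /=.
    move=> /existsNP[k /forallNP Nk]; exists k => // j _ /=.
    by rewrite ltnNge; apply/negP; exact: Nk.
  by move=> [k _ Nk] Dw; have [j] := Dw k; rewrite leqNgt (Nk j).
have mlt k t : 0 <= t -> measurable [set w | (N t w < k)%N].
  by move=> t0; exact: (measurable_preimage_process HN [set n | (n < k)%N]).
have mcap k : measurable (\bigcap_(j : nat) [set w | (N j%:R w < k)%N]).
  by apply: bigcap_measurable => // j _; exact: mlt.
apply/negligibleP; [exact: bigcup_measurable|apply: negligible_bigcup => k; apply/negligibleP => //].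
have [C C0 HC] := poisson_tail T theta0 0 k.
set A := \bigcap_(_ in _) _.
apply/eqP; rewrite eq_le measure_ge0 andbT.
have rho1 : expR (- (theta / 2)) < 1 by rewrite expR_lt1 oppr_lt0 divr_gt0.
have Aj j : (P A <= (C * expR (- (theta / 2)) ^+ j)%:E)%E.
  rewrite -[leLHS]mul1e -(expr0 (j.+2%:R : R)).
  apply: le_trans (HC P N HN j); rewrite lee_pmul2l//.
  by apply: le_measure; rewrite ?inE//; [exact: mcap|exact: mlt|exact: bigcap_inf].
have cvg0 : (C * expR (- (theta / 2)) ^+ j)%:E @[j --> \oo] --> 0%E.
  apply: cvg_EFin; first exact: nearW.
  by apply: cvg_geometric; rewrite ger0_norm ?expR_ge0.
rewrite -(cvg_lim _ cvg0)//; apply: lime_ge; first by apply/cvg_ex; exists 0%E.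
exact: nearW.
Qed.

(** If [j] is the last integer time with [N j < k], the arrival is at most [j + 1], so the integrand
    is at most [(j + 2) ^ r] on the event [N j < k]. Summing these majorants over all [j] gives a
    convergent series by [poisson_tail]; the extra 1 covers arrival time 0. *)
Lemma arrival_moment_bound r k : exists B : R,
  forall (P : probability T R) (N : R -> T -> nat), poisson_process P theta N ->
  (\int[P]_(w in reach_all N) ((1 + arrival N k w) ^+ r)%:E <= B%:E)%E.
Proof.
have [C C0 HC] := poisson_tail T theta0 r k.
set rho := expR _ in HC.
have rho1 : rho < 1 by rewrite expR_lt1 oppr_lt0 divr_gt0.
have rho0 : 0 <= rho by exact: expR_ge0.
exists (1 + C / (1 - rho)) => P N HN.
have mD := measurable_reach_all HN.
pose A j := [set w | (N j%:R w < k)%N].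
have mA j : measurable (A j).
  exact: (measurable_preimage_process HN [set n | (n < k)%N]).
pose u j w : \bar R := ((j.+2%:R ^+ r)%:E * (\1_(A j) w)%:E)%E.
have u0 j w : (0 <= u j w)%E by rewrite mule_ge0// lee_fin ?exprn_ge0.
have mu j E : measurable_fun E (u j).
  apply: measurable_funTS; apply: emeasurable_funM => //.
  by apply/measurable_EFinP; exact: measurable_indic.
have ms E : measurable_fun E (fun w => (\sum_(0 <= j <oo) u j w)%E).
  by apply: ge0_emeasurable_sum.
apply: (@le_trans _ _ (\int[P]_(w in reach_all N) (1 + \sum_(0 <= j <oo) u j w))%E).
  apply: ge0_le_integral => //.
  - by move=> w _; rewrite lee_fin exprn_ge0// addr_ge0// arrival_ge0.
  - apply/measurable_EFinP/measurable_funTS/measurable_funX/measurable_funD => //.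
    exact: measurable_arrival HN _.
  - exact: emeasurable_funD.
  - move=> w Dw.
    have sum0 : (0 <= \sum_(0 <= j <oo) u j w)%E by exact: nneseries_ge0.
    case: (ex_minnP (Dw k)) => -[kj _|j kj jmin].
      have s0 : arrival N k w <= 0 by rewrite (arrival_le HN).
      have -> : arrival N k w = 0 by apply/eqP; rewrite eq_le s0 arrival_ge0.
      by rewrite addr0 expr1n leeDl.
    have /negP Nj : ~ (k <= N j%:R w)%N.
      by move=> /jmin; rewrite ltnn.
    apply: (@le_trans _ _ (u j w)).
      rewrite /u indicE mem_set ?mule1 ?lee_fin; last by rewrite /A/= ltnNge.
      rewrite lerXn2r ?nnegrE ?ler0n ?addr_ge0 ?arrival_ge0//.
      by rewrite -[j.+2]add1n natrD lerD2l (arrival_le HN).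
    apply: (@le_trans _ _ (\sum_(0 <= i < j.+1) u i w)%E).
      by rewrite big_nat_recr//= leeDr// sume_ge0.
    by rewrite (le_trans (nneseries_lim_ge _ _))// leeDr.
rewrite ge0_integralD//; last first.
  by move=> w _; exact: nneseries_ge0.
rewrite EFinD leeD//.
  by rewrite integral_cst//= mul1e probability_le1.
rewrite integral_nneseries//; apply: nneseries_le_geometric => // j.
  exact: integral_ge0.
apply: le_trans (HC P N HN j).
rewrite ge0_integralZl//; last first.
  by apply/measurable_EFinP/measurable_funTS; exact: measurable_indic.
rewrite lee_pmul2l ?lte_fin ?exprn_gt0//.
rewrite integral_indic//; apply: le_measure; rewrite ?inE//; first exact: measurableI.
exact: mA.
Qed.

End moments.

(** * The process restarted at time [h], under conditioning on [N h] *)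

Definition shift_process {R : realType} {d : measure_display}
    {T : measurableType d} (h : R) (N : R -> T -> nat) : R -> T -> nat :=
  fun t w => (N (h + t)%R w - N h w)%N.

Section shift.
Context (R : realType) (d : measure_display) (T : measurableType d).
Variables (P : probability T R) (theta : R) (N : R -> T -> nat).
Hypothesis HN : poisson_process P theta N.
Variable h : R.
Hypothesis h0 : 0 <= h.
Let N' := shift_process h N.

Lemma shift_processB s t w : 0 <= s -> s <= t ->
  (N' t w - N' s w = N (h + t)%R w - N (h + s)%R w)%N.
Proof.
move=> s0 st; rewrite /N' /shift_process -subnDA subnKC//.
by apply: (poisson_process_nondecreasing HN) => //; rewrite lerDl.
Qed.

Lemma reach_all_shift : reach_all N' = reach_all N.
Proof.
have mono := poisson_process_nondecreasing HN.
have [m hm] : exists m : nat, h <= m%:R.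
  by exists (Num.bound h); exact/ltW/archi_boundP.
apply/seteqP; split => w Dw k.
  have [j kj] := Dw k; exists (m + j)%N; rewrite (leq_trans kj)//.
  rewrite /N' /shift_process (leq_trans (leq_subr _ _))//.
  by apply: mono; rewrite ?addr_ge0// natrD lerD2r.
have [j kj] := Dw (N h w + k)%N; exists j.
rewrite /N' /shift_process leq_subRL; last by apply: mono; rewrite ?lerDl.
by rewrite (leq_trans kj)//; apply: mono; rewrite ?lerDr.
Qed.

(** Both [N h] and the increments of the restarted process are increments of [N] over successive
    intervals, so independence of the increments of [N] applies. *)
Lemma shift_independent (B0 : set nat) n (t : nat -> R) (B : 'I_n -> set nat) :
  0 <= t 0%N -> (forall i, t i <= t i.+1) ->
  P [set w | B0 (N h w) /\ forall i : 'I_n, B i (N' (t i.+1) w - N' (t i) w)%N] =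
  (P [set w | B0 (N h w)] *
   \prod_(i < n) P [set w | B i (N' (t i.+1) w - N' (t i) w)%N])%E.
Proof.
move=> t00 tS.
have t0 i : 0 <= t i by elim: i => // i IH; rewrite (le_trans IH).
(* The times are [0, h, h + t 0, h + t 1, ...]. The increment over [[h, h + t 0]] is left
   unconstrained, hence the set [setT] in second position of [B']. *)
pose u i := match i with 0%N => 0 | 1%N => h | i.+2 => h + t i end : R.
have uS i : u i <= u i.+1 by case: i => [|[|i]] //=; rewrite ?lerDl// lerD2l.
pose B' (i : 'I_n.+2) := match unlift ord0 i with
  | None => B0
  | Some j => match unlift ord0 j with None => setT | Some k => B k end end.
have B'0 : B' ord0 = B0 by rewrite /B' unlift_none.
have B'1 : B' (lift ord0 ord0) = setT by rewrite /B' liftK unlift_none.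
have B'2 i : B' (lift ord0 (lift ord0 i)) = B i by rewrite /B' !liftK.
have N'B i w : (N' (t i.+1) w - N' (t i) w = N (u i.+3) w - N (u i.+2) w)%N.
  exact: shift_processB.
have := poisson_process_independent_increments HN (n := n.+2) (t := u) (lexx _) uS (B := B').
move=> /(_ (fun i => I)).
rewrite !big_ord_recl B'0 B'1 /= probability_setT mul1e.
have -> : [set w | B0 (N h w - N 0 w)%N] = [set w | B0 (N h w)].
  by apply/seteqP; split => w /=; rewrite (poisson_process_start HN) subn0.
move=> E; transitivity (P [set w | forall i : 'I_n.+2, B' i (N (u i.+1) w - N (u i) w)%N]).
  congr (P _); apply/seteqP; split => w /=.
    move=> [Bw0 Bw] i; case: (unliftP ord0 i) => [j ->|->]; last first.
      by rewrite B'0/= (poisson_process_start HN) subn0.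
    case: (unliftP ord0 j) => [k ->|->]; last by rewrite B'1.
    by rewrite B'2 !lift0; have := Bw k; rewrite N'B.
  move=> Bw; split; first by have := Bw ord0; rewrite B'0/= (poisson_process_start HN) subn0.
  by move=> i; have := Bw (lift ord0 (lift ord0 i)); rewrite B'2 !lift0 N'B.
rewrite E; congr (_ * _)%E; apply: eq_bigr => i _; rewrite B'2; congr (P _).
by apply/seteqP; split => w /=; rewrite N'B.
Qed.

(** The path properties hold pointwise whatever the probability. The law and the independence of
    increments follow once [Q] gives every finite family of increments the product of its marginals
    under [P]. *)
Lemma shift_poisson (Q : probability T R) :
  (forall n (t : nat -> R) (B : 'I_n -> set nat),
    0 <= t 0%N -> (forall i, t i <= t i.+1) ->
    Q [set w | forall i : 'I_n, B i (N' (t i.+1) w - N' (t i) w)%N] =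
    (\prod_(i < n) P [set w | B i (N' (t i.+1) w - N' (t i) w)%N])%E) ->
  poisson_process Q theta N'.
Proof.
move=> HQ.
have HQ1 s t (B : set nat) : 0 <= s -> s <= t ->
    Q [set w | B (N' t w - N' s w)%N] = P [set w | B (N' t w - N' s w)%N].
  move=> s0 st.
  (* A single increment: the times [s, t, t, ...] show that [Q] and [P] have the same marginals. *)
  have := HQ 1%N (fun i => if i == 0%N then s else t) (fun=> B) s0.
  rewrite big_ord1/= => <-; last by case.
  by congr (Q _); apply/seteqP; split => w /=; [move=> ? i; rewrite (ord1 i)|move=> /(_ ord0)].
split.
- move=> t t0 _ B _; rewrite setTI.
  rewrite (_ : _ @^-1` _ = \bigcup_(a : nat) \bigcup_(b in [set b | B (b - a)%N])
     ([set w | N h w = a] `&` [set w | N (h + t) w = b])).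
    apply: bigcup_measurable => a _; apply: bigcup_measurable => b _.
    apply: measurableI.
      exact: (measurable_preimage_process HN [set n | n = a]).
    by apply: (measurable_preimage_process HN [set n | n = b]); rewrite addr_ge0.
  apply/seteqP; split => w /=.
    by move=> Bw; exists (N h w) => //; exists (N (h + t) w).
  by move=> [a _ [b Bb /= [Na Nb]]]; rewrite /N' /shift_process Na Nb.
- by move=> w; rewrite /N' /shift_process addr0 subnn.
- move=> w s t s0 st; rewrite leq_sub2r//.
  by apply: (poisson_process_nondecreasing HN); rewrite ?addr_ge0// lerD2l.
- move=> w t t0.
  have /nbhs_ballP[e /= e0 He] :=
    poisson_process_right_continuous HN w (addr_ge0 h0 t0).
  apply/nbhs_ballP; exists e => //= s ts lts.
  rewrite /N' /shift_process He// ?ltrD2l//.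
  by move: ts; rewrite /ball/= opprD addrACA subrr add0r.
- move=> s t s0 st k.
  rewrite (HQ1 _ _ [set k] s0 (ltW st))/=.
  rewrite (_ : t - s = (h + t) - (h + s)); last by rewrite opprD addrACA subrr add0r.
  rewrite -(poisson_process_increments HN); last 2 first.
  + by rewrite addr_ge0.
  + by rewrite ltrD2l.
  congr (P _); apply/seteqP; split => w /=; rewrite shift_processB//; exact: ltW.
- move=> n t t00 tS B _; rewrite (HQ n t B t00 tS); apply: eq_bigr => i _.
  apply/esym/HQ1 => //; elim: (nat_of_ord i) => // j IH; exact: le_trans IH (tS _).
Qed.

(** [Q] is [P] conditioned on [B0 (N h)]. By independence the conditioning leaves the increments of
    the restarted process with their law, and the integral identity is the definition of conditional
    expectation given this event. *)
Lemma shift_conditional (B0 : set nat) : exists2 Q : probability T R,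
  poisson_process Q theta N' &
  forall f : T -> \bar R, measurable_fun (reach_all N) f ->
    (forall w, reach_all N w -> 0 <= f w)%E ->
    (\int[P]_(w in reach_all N `&` [set w | B0 (N h w)]) f w =
     P [set w | B0 (N h w)] * \int[Q]_(w in reach_all N) f w)%E.
Proof.
set E := [set w | B0 (N h w)].
have mE : measurable E by exact: measurable_preimage_process HN _ _ h0.
have mD := measurable_reach_all HN.
have [PE0|PE0] := eqVneq (P E) 0%E.
  (* On a null event both sides of the integral identity vanish, and [P] itself serves, by
     [shift_independent] with the sure event. *)
  exists P.
    apply: shift_poisson => n t B t00 tS.
    have := shift_independent setT B t00 tS.
    rewrite [X in P X = _ -> _](_ : _ = [set w | forall i : 'I_n, B i (N' (t i.+1) w - N' (t i) w)%N]).
      by move=> ->; rewrite [X in (P X * _)%E](_ : _ = setT) ?probability_setT ?mul1e.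
    by apply/seteqP; split => w /=; [case|split].
  move=> f mf f0; rewrite PE0 mul0e.
  rewrite (ge0_negligible_integral mE)//; last 3 first.
  - exact: measurableI.
  - by apply: measurable_funS mf.
  - by move=> w [Dw _]; exact: f0.
  rewrite (_ : _ `\` E = set0) ?integral_set0//.
  by apply/seteqP; split => // w /= [[]].
have PEfin : P E \is a fin_num by exact: fin_num_measure.
pose p := fine (P E).
have p0 : 0 < p by rewrite fine_gt0// lt0e PE0 measure_ge0/= -ge0_fin_numE.
(* The restriction to [E] divided by its mass. The last argument [P] is the default for a mass 0 or
   infinite, both excluded here. *)
pose Q : probability T R := mnormalize (mrestr P mE) P.
have QE U : Q U = (P (U `&` E) * p^-1%:E)%E.
  rewrite /Q/= /mnormalize/= /mrestr classical_sets.setTI (negbTE PE0)/=.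
  by case: ifPn => // /eqP PEy; move: PEfin; rewrite PEy.
have PEp : P E = p%:E by rewrite fineK.
exists Q.
  apply: shift_poisson => n t B t00 tS; rewrite QE.
  rewrite [X in P X](_ : _ = [set w | B0 (N h w) /\
      forall i : 'I_n, B i (N' (t i.+1) w - N' (t i) w)%N]).
    rewrite (shift_independent B0 B t00 tS) -/E PEp muleAC -EFinM divff ?mul1e//.
    by rewrite lt0r_neq0.
  by apply/seteqP; split => w [].
move=> f mf f0; rewrite PEp.
have p0' : 0 <= p by exact: ltW.
have pQE U : (p%:E * Q U)%E = P (U `&` E).
  by rewrite QE muleCA -EFinM divff ?mule1 ?lt0r_neq0.
(* The measure [p Q] gives no mass to the complement of [E] and agrees with [P] on measurable
   subsets of [E]. *)
rewrite -[p]/((NngNum p0')%:num) -ge0_integral_mscale//.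
rewrite [RHS](ge0_negligible_integral (measurableC mE))//; last first.
  apply: (eq_trans (pQE _)); by rewrite classical_sets.setICl measure0.
rewrite (_ : _ `\` ~` E = reach_all N `&` E); last by rewrite classical_sets.setDE classical_sets.setCK.
apply: eq_measure_integral => A mA AE.
apply/esym/(eq_trans (pQE _)).
by rewrite classical_sets.setIidl// => w /AE[].
Qed.

End shift.

(** * Taylor bounds for polynomials with nonnegative coefficients *)

Section nonneg_poly.
Context {R : realFieldType}.
Implicit Types (p : {poly R}) (h : R).

Lemma horner_nneg p h : p \is a polyOver Num.nneg -> 0 <= h -> 0 <= p.[h].
Proof.
move=> /polyOverP p0 h0; rewrite horner_coef; apply: sumr_ge0 => i _.
by rewrite mulr_ge0 ?exprn_ge0//; exact: p0.
Qed.

(** For [h] in [[0, 1]] every positive power of [h] is at most [h], and the sum of the coefficients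
    is [p.[1]]; this gives an explicit remainder. *)
Lemma nneg_poly_taylor1 p h : p \is a polyOver Num.nneg -> 0 <= h <= 1 ->
  p.[0] <= p.[h] <= p.[0] + h * p.[1].
Proof.
elim/poly_ind: p => [|q c _] /polyOverP pP /andP[h0 h1].
  by rewrite !horner0 mulr0 addr0 lexx.
have qP : q \is a polyOver Num.nneg.
  by apply/polyOverP => i; have := pP i.+1; rewrite coefD coefMX coefC addr0.
have c0 : 0 <= c by have := pP 0%N; rewrite coefD coefMX coefC add0r.
rewrite !hornerE; apply/andP; split; first by rewrite lerDr mulr_ge0 ?horner_nneg.
rewrite addrC lerD2l mulrC ler_wpM2l//.
rewrite ler_wpDr//.
rewrite !horner_coef; apply: ler_sum => i _; rewrite expr1n.
by rewrite ler_wpM2l ?exprn_ile1//; move/polyOverP: qP; exact.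
Qed.

(** Writing [p = q * 'X + c], this is the first order bound for [q] multiplied by [h]. *)
Lemma nneg_poly_taylor2 p h : p \is a polyOver Num.nneg -> 0 <= h <= 1 ->
  p.[0] + h * (deriv p).[0] <= p.[h] <= p.[0] + h * (deriv p).[0] + h ^+ 2 * p.[1].
Proof.
elim/poly_ind: p => [|q c _] /polyOverP pP /[dup] h01 /andP[h0 h1].
  by rewrite deriv0 !horner0 !mulr0 !addr0 lexx.
have qP : q \is a polyOver Num.nneg.
  by apply/polyOverP => i; have := pP i.+1; rewrite coefD coefMX coefC addr0.
have c0 : 0 <= c by have := pP 0%N; rewrite coefD coefMX coefC add0r.
have /andP[q1 q2] := nneg_poly_taylor1 qP h01.
rewrite !poly.derivE !hornerE/= [q.[h] * h + c]addrC -!addrA !lerD2l.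
rewrite [q.[h] * h]mulrC; apply/andP; split; first by rewrite ler_wpM2l.
apply: (le_trans (ler_wpM2l h0 q2)).
by rewrite mulrDr lerD2l expr2 mulrA ler_wpM2l ?mulr_ge0// lerDl.
Qed.

Let polyOver_nnegM p q : p \is a polyOver Num.nneg ->
  q \is a polyOver Num.nneg -> p * q \is a polyOver Num.nneg.
Proof.
move=> /polyOverP pP /polyOverP qP; apply/polyOverP => i.
by rewrite coefM rpred_sum// => j _; rewrite rpredM.
Qed.

Let polyOver_nnegX p n : p \is a polyOver Num.nneg ->
  p ^+ n \is a polyOver Num.nneg.
Proof.
move=> pP; elim: n => [|n IHn]; last by rewrite exprS polyOver_nnegM.
by rewrite expr0 polyOverC rpred1.
Qed.

Let polyOver_nneg_affine (a b : R) : 0 <= a -> 0 <= b ->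
  a *: 'X + b%:P \is a polyOver Num.nneg.
Proof.
move=> a0 b0; apply/polyOverP => i; rewrite coefD coefZ coefX coefC.
by rewrite rpredD//; [rewrite rpredM ?rpred_nat|case: ifP => //; rewrite rpred0].
Qed.

Let affmono (a b x : R) m n : {poly R} := ('X + a%:P) ^+ m * (x *: 'X + b%:P) ^+ n.

Let affmono_nneg a b x m n : 0 <= a -> 0 <= b -> 0 <= x ->
  affmono a b x m n \is a polyOver Num.nneg.
Proof.
move=> a0 b0 x0; have -> : affmono a b x m n =
    (1 *: 'X + a%:P) ^+ m * (x *: 'X + b%:P) ^+ n by rewrite scale1r.
by rewrite polyOver_nnegM// polyOver_nnegX// polyOver_nneg_affine.
Qed.

Lemma monomial_taylor1 (a b x h : R) m n :
  0 <= a -> 0 <= b -> 0 <= x -> 0 <= h <= 1 ->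
  (h + a) ^+ m * (x * h + b) ^+ n <=
    a ^+ m * b ^+ n + h * ((1 + a) ^+ m * (x + b) ^+ n).
Proof.
move=> a0 b0 x0 h01.
have /andP[_] := nneg_poly_taylor1 (affmono_nneg m n a0 b0 x0) h01.
by rewrite /affmono !hornerE/= ?mulr0 ?mulr1 ?add0r.
Qed.

(** With [a] and [b] the duration and area still to come, a wait of [h] at height [x] adds [h] and
    [x * h]. The derivative at 0 yields the lower order terms of the recursion; when [m] or [n] is
    0, the truncated predecessor is multiplied by 0. *)
Lemma monomial_taylor2 (a b x h : R) m n :
  0 <= a -> 0 <= b -> 0 <= x -> 0 <= h <= 1 ->
  a ^+ m * b ^+ n +
      h * (m%:R * (a ^+ m.-1 * b ^+ n) + n%:R * x * (a ^+ m * b ^+ n.-1)) <=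
    (h + a) ^+ m * (x * h + b) ^+ n <=
  a ^+ m * b ^+ n +
      h * (m%:R * (a ^+ m.-1 * b ^+ n) + n%:R * x * (a ^+ m * b ^+ n.-1)) +
    h ^+ 2 * ((1 + a) ^+ m * (x + b) ^+ n).
Proof.
move=> a0 b0 x0 h01.
have := nneg_poly_taylor2 (affmono_nneg m n a0 b0 x0) h01.
have -> : (deriv (affmono a b x m n)).[0] =
  m%:R * (a ^+ m.-1 * b ^+ n) + n%:R * x * (a ^+ m * b ^+ n.-1).
  rewrite /affmono derivM !deriv_exp !poly.derivE !hornerE/= ?hornerMn !hornerE/=.
  rewrite ?mulr0 ?add0r; ring.
by rewrite /affmono !hornerE/= ?mulr0 ?mulr1 ?add0r.
Qed.

End nonneg_poly.

(** * Duration and area as functions of the arrival times, and their shifts *)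

Section area.
Context (R : realType) (d : measure_display) (T : measurableType d).
Variable al : R.
Hypotheses (al0 : 0 < al) (al1 : al <= 1).

(** The index is one more than the integer part: [area_sum N k.+1] is the area from [k + al], its
    term [i = 0] being zero. Index 0 stands for the start [al - 1 <= 0], with area 0, so one jump
    always lowers the index by one. *)
Definition area_sum (N : R -> T -> nat) (k : nat) (w : T) : R :=
  \sum_(i < k) arrival N i w + al * arrival N k w.

Lemma area_sum_ge0 N k w : 0 <= area_sum N k w.
Proof.
rewrite addr_ge0 ?mulr_ge0 ?arrival_ge0 ?(ltW al0)//.
by apply: sumr_ge0 => i _; exact: arrival_ge0.
Qed.

Lemma area_sumS N k w : area_sum N k.+1 w =
  \sum_(i < k) arrival N i.+1 w + al * arrival N k.+1 w.
Proof. by rewrite /area_sum big_ord_recl arrival0 add0r. Qed.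

Definition power_mono (N : R -> T -> nat) (m n k : nat) (w : T) : R :=
  arrival N k w ^+ m * area_sum N k w ^+ n.

Lemma power_mono_ge0 N m n k w : 0 <= power_mono N m n k w.
Proof. by rewrite mulr_ge0 ?exprn_ge0 ?arrival_ge0 ?area_sum_ge0. Qed.

Section paths.
Variables (P : probability T R) (theta : R) (N : R -> T -> nat).
Hypothesis HN : poisson_process P theta N.

Lemma measurable_power_mono m n k D : measurable_fun D (power_mono N m n k).
Proof.
apply: measurable_funTS; apply: measurable_funM; apply: measurable_funX.
  exact: measurable_arrival HN _.
apply: measurable_funD.
  by apply: measurable_sum => i; exact: measurable_arrival HN _.
by apply: measurable_funM => //; exact: measurable_arrival HN _.
Qed.

Lemma area_sum_le k w : reach_all N w ->
  area_sum N k.+1 w <= (k%:R + al) * arrival N k.+1 w.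
Proof.
move=> Dw; rewrite area_sumS mulrDl lerD2r.
rewrite -[k in k%:R]card_ord mulr_natl -sumr_const.
by apply: ler_sum => i _; apply: (le_arrival HN) => //; rewrite ltnS ltnW.
Qed.

Lemma area_sum_leS k w : reach_all N w -> area_sum N k w <= area_sum N k.+1 w.
Proof.
move=> Dw; rewrite area_sumS lerD//.
  by apply: ler_sum => i _; apply: (le_arrival HN).
by rewrite ler_wpM2l ?(ltW al0)//; apply: (le_arrival HN).
Qed.

(** A common majorant for the Taylor remainders at [j = k.+1] (no jump) and [j = k] (one jump), in
    terms of one arrival time. It rests on bounding the area by the initial height times the
    duration. *)
Lemma power_mono_bump_le m n k j w : reach_all N w -> (j <= k.+1 <= j.+1)%N ->
  (1 + arrival N j w) ^+ m * (k%:R + al + area_sum N j w) ^+ n <=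
  (k%:R + al) ^+ n * (1 + arrival N k.+1 w) ^+ (m + n).
Proof.
move=> Dw /andP[jk kj].
have x0 : 0 <= k%:R + al by rewrite addr_ge0 ?(ltW al0).
have aj : arrival N j w <= arrival N k.+1 w by apply: (le_arrival HN).
have Aj : area_sum N j w <= area_sum N k.+1 w.
  move: jk kj; rewrite leq_eqVlt => /predU1P[->//|]; rewrite !ltnS => jk kj.
  have -> : j = k by apply/eqP; rewrite eqn_leq jk.
  exact: area_sum_leS.
have s0 i : 0 <= 1 + arrival N i w by rewrite addr_ge0 ?arrival_ge0.
have a0 : 0 <= k%:R + al + area_sum N j w by rewrite addr_ge0 ?area_sum_ge0.
rewrite exprD mulrCA ler_pM ?exprn_ge0//.
  by rewrite lerXn2r ?nnegrE ?s0// lerD2l.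
rewrite -exprMn lerXn2r ?nnegrE ?(mulr_ge0 x0 (s0 _))//.
by rewrite mulrDr mulr1 lerD2l (le_trans Aj)// area_sum_le.
Qed.

Section shift.
Variable h : R.
Hypothesis h0 : 0 <= h.
Let N' := shift_process h N.

Lemma arrival_shift_le k t w : reach_all N w -> 0 <= t ->
  (arrival N' k w <= t) = (k <= N (h + t) w - N h w)%N.
Proof.
(* Conditioning on the sure event provides a probability under which the restarted process is
   Poisson, so that the path lemma [arrival_le] applies to it. *)
move=> Dw t0; have [Q HN' _] := shift_conditional HN h0 setT.
by rewrite (arrival_le HN')// (reach_all_shift HN).
Qed.

Let N_shift t w : 0 <= t -> (N h w <= N (h + t) w)%N.
Proof. by move=> t0; rewrite (poisson_process_nondecreasing HN)// lerDl. Qed.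

Lemma arrival_le_shift k w : reach_all N w ->
  arrival N k w <= h + arrival N' k w.
Proof.
move=> Dw; rewrite (arrival_le HN) ?addr_ge0 ?arrival_ge0//.
have := lexx (arrival N' k w); rewrite {1}arrival_shift_le ?arrival_ge0// => /leq_trans; apply.
exact: leq_subr.
Qed.

Lemma arrival_shift_eq0 k w : reach_all N w -> N h w = 0%N ->
  arrival N k.+1 w = h + arrival N' k.+1 w.
Proof.
move=> Dw Nh; apply/eqP; rewrite eq_le arrival_le_shift//=.
have ks : (k < N (arrival N k.+1 w) w)%N by rewrite -(arrival_le HN) ?arrival_ge0.
have hs : h <= arrival N k.+1 w.
  rewrite leNgt; apply/negP => /ltW sh.
  by move: ks; rewrite ltnNge (leq_trans (poisson_process_nondecreasing HN _ _ sh)) ?Nh ?arrival_ge0.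
by rewrite -lerBrDl arrival_shift_le ?subr_ge0// Nh subn0 subrKC.
Qed.

(** One jump has already happened, so [k] more are awaited. Its position inside [[0, h]] is unknown,
    which costs at most [h]. *)
Lemma arrival_shift_eq1 k w : reach_all N w -> N h w = 1%N ->
  arrival N' k w <= arrival N k.+1 w <= h + arrival N' k w.
Proof.
move=> Dw Nh; apply/andP; split.
  rewrite arrival_shift_le ?arrival_ge0// Nh leq_subRL; last first.
    by rewrite -Nh N_shift ?arrival_ge0.
  rewrite add1n (@leq_trans (N (arrival N k.+1 w) w))//.
    by rewrite -(arrival_le HN) ?arrival_ge0.
  by rewrite (poisson_process_nondecreasing HN) ?arrival_ge0// lerDr.
rewrite (arrival_le HN) ?addr_ge0 ?arrival_ge0//.
have := lexx (arrival N' k w); rewrite {1}arrival_shift_le ?arrival_ge0//.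
by rewrite Nh leq_subRL ?add1n// -Nh N_shift ?arrival_ge0.
Qed.

Lemma area_shift_eq0 k w : reach_all N w -> N h w = 0%N ->
  area_sum N k.+1 w = (k%:R + al) * h + area_sum N' k.+1 w.
Proof.
move=> Dw Nh; rewrite !area_sumS.
under eq_bigr do rewrite arrival_shift_eq0//.
rewrite arrival_shift_eq0// big_split/= sumr_const card_ord -mulr_natl; ring.
Qed.

Lemma area_le_shift k w : reach_all N w ->
  area_sum N k.+1 w <= (k%:R + al) * h + area_sum N' k.+1 w.
Proof.
move=> Dw; rewrite !area_sumS.
apply: (@le_trans _ _ (\sum_(i < k) (h + arrival N' i.+1 w) +
    al * (h + arrival N' k.+1 w))).
  by rewrite lerD ?ler_sum ?ler_wpM2l ?(ltW al0) => // *; exact: arrival_le_shift.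
rewrite big_split/= sumr_const card_ord -mulr_natl le_eqVlt.
by apply/orP; left; apply/eqP; ring.
Qed.

Lemma area_shift_eq1 k w : reach_all N w -> N h w = 1%N ->
  area_sum N' k w <= area_sum N k.+1 w <= (k%:R + al) * h + area_sum N' k w.
Proof.
move=> Dw Nh; rewrite area_sumS.
have arrs i := @arrival_shift_eq1 i w Dw Nh.
apply/andP; split.
  rewrite lerD ?ler_sum ?ler_wpM2l ?(ltW al0) => // [i _|].
    by case/andP: (arrs i).
  by case/andP: (arrs k).
apply: (@le_trans _ _ (\sum_(i < k) (h + arrival N' i w) +
    al * (h + arrival N' k w))).
  rewrite lerD ?ler_sum ?ler_wpM2l ?(ltW al0) => // [i _|].
    by case/andP: (arrs i).
  by case/andP: (arrs k).
rewrite big_split/= sumr_const card_ord -mulr_natl /area_sum le_eqVlt.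
by apply/orP; left; apply/eqP; ring.
Qed.

End shift.
End paths.
End area.

(** * Expansion of the moments over one short time step *)

Lemma ge0_integralDZ (R : realType) (d : measure_display) (T : measurableType d)
    (mu : {measure set T -> \bar R}) (D : set T) (f g : T -> R) (c : R) :
  measurable D -> measurable_fun D f -> measurable_fun D g ->
  (forall w, 0 <= f w) -> (forall w, 0 <= g w) -> 0 <= c ->
  (\int[mu]_(w in D) (f w + c * g w)%:E =
   \int[mu]_(w in D) (f w)%:E + c%:E * \int[mu]_(w in D) (g w)%:E)%E.
Proof.
move=> mD mf mg f0 g0 c0.
under eq_integral do rewrite EFinD EFinM.
rewrite ge0_integralD//; last 4 first.
- by move=> w _; rewrite lee_fin.
- exact/measurable_EFinP.
- by move=> w _; rewrite -EFinM lee_fin mulr_ge0.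
- by apply: emeasurable_funM => //; exact/measurable_EFinP.
rewrite ge0_integralZl//; first exact/measurable_EFinP.
by move=> w _; rewrite lee_fin.
Qed.

Section one_step.
Context (R : realType) (d : measure_display) (T : measurableType d).
Variables (theta al : R).
Hypotheses (theta0 : 0 < theta) (al0 : 0 < al) (al1 : al <= 1).

Definition moment (P : probability T R) (N : R -> T -> nat) (m n k : nat) : \bar R :=
  (\int[P]_(w in reach_all N) (power_mono al N m n k w)%:E)%E.

(** The majorant of [power_mono_bump_le]; its mean is bounded uniformly over all Poisson processes
    of intensity [theta]. *)
Let dom m n k (N : R -> T -> nat) (w : T) : R :=
  (k%:R + al) ^+ n * (1 + arrival N k.+1 w) ^+ (m + n).

Let x0 k : 0 <= k%:R + al. Proof. by rewrite addr_ge0 ?(ltW al0). Qed.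

Let dom0 m n k N w : 0 <= dom m n k N w.
Proof. by rewrite mulr_ge0 ?exprn_ge0 ?addr_ge0 ?arrival_ge0 ?(ltW al0). Qed.

Let measurable_dom (P : probability T R) N m n k D :
  poisson_process P theta N -> measurable_fun D (dom m n k N).
Proof.
move=> HN; apply: measurable_funTS; apply: measurable_funM => //.
apply: measurable_funX; apply: measurable_funD => //.
exact: measurable_arrival HN _.
Qed.

Let dom_bound m n k : exists2 K : R, 0 <= K &
  forall (P : probability T R) (N : R -> T -> nat), poisson_process P theta N ->
  (\int[P]_(w in reach_all N) (dom m n k N w)%:E <= K%:E)%E.
Proof.
have [B HB] := arrival_moment_bound T theta0 (m + n) k.+1.
exists ((k%:R + al) ^+ n * `|B|); first by rewrite mulr_ge0 ?exprn_ge0.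
move=> P N HN; under eq_integral do rewrite EFinM.
rewrite ge0_integralZl//.
- rewrite EFinM lee_wpmul2l ?lee_fin ?exprn_ge0//.
  by rewrite (le_trans (HB P N HN))// lee_fin ler_norm.
- exact: measurable_reach_all HN.
- apply/measurable_EFinP/measurable_funTS/measurable_funX/measurable_funD => //.
  exact: measurable_arrival HN _.
- by move=> w _; rewrite lee_fin exprn_ge0// addr_ge0// arrival_ge0.
- by rewrite lee_fin exprn_ge0.
Qed.

Let power_mono_le_dom (P : probability T R) N m n k j w : poisson_process P theta N ->
  reach_all N w -> (j <= k.+1 <= j.+1)%N -> power_mono al N m n j w <= dom m n k N w.
Proof.
move=> HN Dw jk; apply: (le_trans _ (power_mono_bump_le al0 HN m n Dw jk)).
rewrite ler_pM ?exprn_ge0 ?arrival_ge0 ?area_sum_ge0//.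
  by rewrite lerXn2r ?nnegrE ?addr_ge0 ?arrival_ge0// lerDr.
have A0 := area_sum_ge0 al0 N j w.
by rewrite lerXn2r ?nnegrE ?(addr_ge0 (x0 k) A0)// lerDr.
Qed.

Lemma moment_ge0 (P : probability T R) N m n k : (0 <= moment P N m n k)%E.
Proof. by apply: integral_ge0 => w _; rewrite lee_fin power_mono_ge0. Qed.

Lemma moment_bound m n k : exists2 K : R, 0 <= K &
  forall (P : probability T R) (N : R -> T -> nat), poisson_process P theta N ->
  (moment P N m n k <= K%:E)%E.
Proof.
have [K K0 HK] := dom_bound m n k; exists K => // P N HN.
apply: le_trans (HK P N HN); apply: ge0_le_integral.
- exact: measurable_reach_all HN.
- by move=> w _; rewrite lee_fin power_mono_ge0.
- exact/measurable_EFinP/(measurable_power_mono _ HN).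
- by apply/measurable_EFinP; exact: measurable_dom HN.
- by move=> w Dw; rewrite lee_fin; apply: (power_mono_le_dom _ _ HN); rewrite ?leqnSn ?leqnn.
Qed.

Lemma moment_fin_num (P : probability T R) N m n k :
  poisson_process P theta N -> moment P N m n k \is a fin_num.
Proof.
move=> HN; have [K _ HK] := moment_bound m n k.
by rewrite ge0_fin_numE ?moment_ge0// (le_lt_trans (HK P N HN))// ltry.
Qed.

Let small_jumps_law (P : probability T R) N h : poisson_process P theta N -> 0 < h ->
  [/\ P [set w | N h w = 0%N] = (expR (- (theta * h)))%:E,
      P [set w | N h w = 1%N] = (theta * h * expR (- (theta * h)))%:E &
      P [set w | (1 < N h w)%N] =
        (1 - (1 + theta * h) * expR (- (theta * h)))%:E].
Proof.
move=> HN h0.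
have th0 : 0 < theta * h by exact: mulr_gt0.
have E0 : P [set w | N h w = 0%N] = (expR (- (theta * h)))%:E.
  by rewrite (process_law _ HN)// /poisson_pmf th0 expr0 fact0 invr1 !mul1r.
have E1 : P [set w | N h w = 1%N] = (theta * h * expR (- (theta * h)))%:E.
  by rewrite (process_law _ HN)// /poisson_pmf th0 expr1 invr1 mulr1.
have mN := measurable_preimage_process HN (t := h) _ (ltW h0).
split => //.
rewrite (_ : [set w | (1 < N h w)%N] =
    ~` ([set w | N h w = 0%N] `|` [set w | N h w = 1%N])).
  rewrite probability_setC; last first.
    by apply: measurableU; [exact: (mN [set n | n = 0%N])|exact: (mN [set n | n = 1%N])].
  rewrite measureU; last 3 first.
  - exact: (mN [set n | n = 0%N]).
  - exact: (mN [set n | n = 1%N]).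
  - by apply/seteqP; split => w //= [->].
  transitivity (1 - (expR (- (theta * h)) + theta * h * expR (- (theta * h))))%:E.
    by rewrite EFinB EFinD -E0 -E1.
  by congr EFin; ring.
apply/seteqP; split => w /=.
  by move=> N1 [] N0; rewrite N0 in N1.
by case: (N h w) => [[]|[[]|]]//; [left|right].
Qed.

Lemma moment_split (P : probability T R) N m n k h :
  poisson_process P theta N -> 0 < h ->
  (moment P N m n k =
   \int[P]_(w in reach_all N `&` [set w | [set 0%N] (N h w)])
      (power_mono al N m n k w)%:E +
   \int[P]_(w in reach_all N `&` [set w | [set 1%N] (N h w)])
      (power_mono al N m n k w)%:E +
   \int[P]_(w in reach_all N `&` [set w | [set i | (1 < i)%N] (N h w)])
      (power_mono al N m n k w)%:E)%E.
Proof.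
move=> HN h0.
have mD := measurable_reach_all HN.
have mN (B : set nat) : measurable (reach_all N `&` [set w | B (N h w)]).
  by apply: measurableI => //; exact: (measurable_preimage_process HN B (ltW h0)).
have mf D : measurable_fun D (fun w => (power_mono al N m n k w)%:E).
  exact/measurable_EFinP/(measurable_power_mono _ HN).
have f0 w : (0 <= (power_mono al N m n k w)%:E)%E by rewrite lee_fin power_mono_ge0.
rewrite -ge0_integral_setU//; last first.
  by apply/disj_setPS => w /= [[_ ->] []].
rewrite -ge0_integral_setU//; last 2 first.
- exact: measurableU.
- by apply/disj_setPS => w /= [[[_ ->]|[_ ->]] []].
congr (integral _ _ _); apply/seteqP; split => w /=; last by move=> [[[]|[]]|[]].
by move=> Dw; case Nh: (N h w) => [|[|i]]; [left; left|left; right|right].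
Qed.

(** [K] is fixed before the process and [h]. The sample space is split by [N h]: with no jump the
    second order Taylor bound leaves [h ^+ 2 * K]; with one jump, of probability of order [h], an
    error [h * K] is enough; with more jumps, of probability of order [h ^+ 2], the crude bound [K]
    is enough, and 0 from below. Conditioning on different events gives different probabilities [Q0]
    and [Q1]. *)
Lemma moment_one_step m n k : exists2 K : R, 0 <= K &
  forall (P : probability T R) (N : R -> T -> nat) (h : R),
  poisson_process P theta N -> 0 < h <= 1 ->
  exists Q0 Q1 : probability T R, let N' := shift_process h N in
  [/\ poisson_process Q0 theta N', poisson_process Q1 theta N' &
  let p := expR (- (theta * h)) in
  let v := fine (moment P N m n k.+1) in
  let v' := fine (moment Q0 N' m n k.+1) + h * (
    m%:R * fine (moment Q0 N' m.-1 n k.+1) +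
    n%:R * (k%:R + al) * fine (moment Q0 N' m n.-1 k.+1)) in
  let u := fine (moment Q1 N' m n k) in
  p * v' + theta * h * p * u <= v <=
  p * (v' + h ^+ 2 * K) + theta * h * p * (u + h * K) +
    (1 - (1 + theta * h) * p) * K].
Proof.
have [K K0 HK] := dom_bound m n k; exists K => // P N h HN /andP[h0 h1].
have h0' := ltW h0.
pose N' := shift_process h N.
have [Q0 HQ0 cond0] := shift_conditional HN h0' [set 0%N].
have [Q1 HQ1 cond1] := shift_conditional HN h0' [set 1%N].
have [Q2 HQ2 cond2] := shift_conditional HN h0' [set i | (1 < i)%N].
exists Q0, Q1; split => //; cbv zeta; rewrite -/N'.
set p := expR (- (theta * h)).
have [P0 P1 P2] := small_jumps_law HN h0; rewrite -/p in P0 P1 P2.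
have mD := measurable_reach_all HN.
have DN' : reach_all N' = reach_all N by exact: reach_all_shift HN _ h0'.
have mg i j l D : measurable_fun D (power_mono al N' i j l).
  exact: (measurable_power_mono _ HQ0).
have mG D : measurable_fun D (dom m n k N') by exact: measurable_dom HQ0.
have mgN D : measurable_fun D (power_mono al N m n k.+1).
  exact: (measurable_power_mono _ HN).
have mN (B : set nat) : measurable (reach_all N `&` [set w | B (N h w)]).
  by apply: measurableI => //; exact: (measurable_preimage_process HN B h0').
have p0 : 0 <= p by exact: expR_ge0.
have h2 : 0 <= h ^+ 2 by exact: exprn_ge0.
have nx : 0 <= n%:R * (k%:R + al) by rewrite mulr_ge0.
(* The first order expansion in [h] of the integrand when no jump has occurred. *)
pose g0 w := power_mono al N' m n k.+1 w +
  (h * m%:R) * power_mono al N' m.-1 n k.+1 w +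
  (h * (n%:R * (k%:R + al))) * power_mono al N' m n.-1 k.+1 w.
have pm i j l w : 0 <= power_mono al N' i j l w by exact: power_mono_ge0.
have c1 : 0 <= h * m%:R by exact: mulr_ge0.
have c2 : 0 <= h * (n%:R * (k%:R + al)) by exact: mulr_ge0.
have g00 w : 0 <= g0 w.
  by rewrite /g0 addr_ge0 ?(mulr_ge0 c2)// addr_ge0 ?(mulr_ge0 c1).
have mg0 D : measurable_fun D g0.
  by rewrite /g0; apply: measurable_funD; [apply: measurable_funD => //|];
    apply: measurable_funM.
have Q_dom (Q : probability T R) : poisson_process Q theta N' ->
    exists2 W : R, 0 <= W <= K & (\int[Q]_(w in reach_all N) (dom m n k N' w)%:E = W%:E)%E.
  move=> HQ; have := HK Q N' HQ; rewrite DN'.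
  have : (0 <= \int[Q]_(w in reach_all N) (dom m n k N' w)%:E)%E.
    by apply: integral_ge0 => w _; rewrite lee_fin dom0.
  case: (integral _ _ _) => // r; rewrite !lee_fin => r0 rK.
  by exists r => //; rewrite r0.
have [W0 /andP[W00 W0K] EW0] := Q_dom Q0 HQ0.
have [W1 /andP[W10 W1K] EW1] := Q_dom Q1 HQ1.
have [W2 /andP[W20 W2K] EW2] := Q_dom Q2 HQ2.
have momQ (Q : probability T R) i j l : poisson_process Q theta N' ->
    (\int[Q]_(w in reach_all N) (power_mono al N' i j l w)%:E =
     (fine (moment Q N' i j l))%:E)%E.
  by move=> HQ; rewrite fineK ?moment_fin_num// /moment DN'.
set v' := (X in p * X + _ <= _).
have Ev' : (\int[Q0]_(w in reach_all N) (g0 w)%:E = v'%:E)%E.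
  rewrite /g0 ge0_integralDZ//; last 2 first.
  - by apply: measurable_funD => //; exact: measurable_funM.
  - by move=> w; rewrite addr_ge0 ?(mulr_ge0 c1).
  rewrite ge0_integralDZ//.
  rewrite !momQ// -!EFinM -!EFinD; congr EFin.
  by rewrite /v'; ring.
set u := fine (moment Q1 N' m n k).
pose I (B : set nat) := (\int[P]_(w in reach_all N `&` [set w | B (N h w)])
  (power_mono al N m n k.+1 w)%:E)%E.
pose x := k%:R + al.
have h01 : 0 <= h <= 1 by rewrite h0'.
(* No jump: duration and area are shifted exactly by [h] and [x h]. *)
have ineq0 w : reach_all N w -> N h w = 0%N ->
    g0 w <= power_mono al N m n k.+1 w <= g0 w + h ^+ 2 * dom m n k N' w.
  move=> Dw Nh; rewrite {1 2}/power_mono (arrival_shift_eq0 HN h0' k Dw Nh).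
  rewrite (area_shift_eq0 al HN h0' k Dw Nh) -/N'.
  have /andP[lo up] := monomial_taylor2 m n (arrival_ge0 N' k.+1 w)
    (area_sum_ge0 al0 N' k.+1 w) (x0 k) h01.
  have g0E : g0 w = arrival N' k.+1 w ^+ m * area_sum al N' k.+1 w ^+ n + h *
      (m%:R * (arrival N' k.+1 w ^+ m.-1 * area_sum al N' k.+1 w ^+ n) +
       n%:R * (k%:R + al) * (arrival N' k.+1 w ^+ m * area_sum al N' k.+1 w ^+ n.-1)).
    by rewrite /g0 /power_mono; ring.
  rewrite g0E lo/= (le_trans up)// lerD2l ler_wpM2l//.
  apply: (power_mono_bump_le al0 HQ0); first by rewrite DN'.
  by rewrite leqnn leqnSn.
(* One jump: duration and area are enclosed between their restarted values at index [k] and these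
   plus [h] and [x h]. *)
have ineq1 w : reach_all N w -> N h w = 1%N ->
    power_mono al N' m n k w <= power_mono al N m n k.+1 w <=
    power_mono al N' m n k w + h * dom m n k N' w.
  move=> Dw Nh.
  have /andP[slo sup] := arrival_shift_eq1 HN h0' k Dw Nh.
  have /andP[alo aup] := area_shift_eq1 al0 HN h0' k Dw Nh.
  apply/andP; split.
    by rewrite ler_pM ?exprn_ge0 ?arrival_ge0 ?area_sum_ge0//;
      rewrite lerXn2r ?nnegrE ?arrival_ge0 ?area_sum_ge0.
  have up := monomial_taylor1 m n (arrival_ge0 N' k w)
    (area_sum_ge0 al0 N' k w) (x0 k) h01.
  apply: (@le_trans _ _ ((h + arrival N' k w) ^+ m *
      ((k%:R + al) * h + area_sum al N' k w) ^+ n)).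
    have a1 : 0 <= h + arrival N' k w by rewrite addr_ge0 ?arrival_ge0.
    have b1 : 0 <= (k%:R + al) * h + area_sum al N' k w.
      by rewrite addr_ge0 ?area_sum_ge0 ?(mulr_ge0 (x0 k)).
    by rewrite ler_pM ?exprn_ge0 ?arrival_ge0 ?area_sum_ge0//;
      rewrite lerXn2r ?nnegrE ?arrival_ge0 ?area_sum_ge0 ?a1 ?b1.
  rewrite (le_trans up)// lerD2l ler_wpM2l//.
  apply: (power_mono_bump_le al0 HQ0); first by rewrite DN'.
  by rewrite leqnSn ltnSn.
(* For any number of jumps, the restart delays arrivals by at most [h <= 1]. *)
have ineq2 w : reach_all N w -> power_mono al N m n k.+1 w <= dom m n k N' w.
  move=> Dw.
  apply: (@le_trans _ _ ((1 + arrival N' k.+1 w) ^+ m *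
      (k%:R + al + area_sum al N' k.+1 w) ^+ n)); last first.
    apply: (power_mono_bump_le al0 HQ0); first by rewrite DN'.
    by rewrite leqnn leqnSn.
  have s1 := arrival_le_shift HN h0' k.+1 Dw.
  have a1 := area_le_shift al0 HN h0' k Dw.
  have s2 : arrival N k.+1 w <= 1 + arrival N' k.+1 w.
    by rewrite (le_trans s1)// lerD2r.
  have a2 : area_sum al N k.+1 w <= k%:R + al + area_sum al N' k.+1 w.
    by rewrite (le_trans a1)// lerD2r ler_piMr.
  have s3 : 0 <= arrival N k.+1 w by exact: arrival_ge0.
  have a3 : 0 <= area_sum al N k.+1 w by exact: area_sum_ge0.
  by rewrite ler_pM ?exprn_ge0//; rewrite lerXn2r ?nnegrE ?(le_trans s3 s2) ?(le_trans a3 a2).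
have mono_int (B : set nat) (f1 f2 : T -> R) :
    (forall D, measurable_fun D f1) -> (forall D, measurable_fun D f2) ->
    (forall w, 0 <= f1 w) ->
    (forall w, reach_all N w -> B (N h w) -> f1 w <= f2 w) ->
    (\int[P]_(w in reach_all N `&` [set w | B (N h w)]) (f1 w)%:E <=
     \int[P]_(w in reach_all N `&` [set w | B (N h w)]) (f2 w)%:E)%E.
  move=> mf1 mf2 f10 f12; apply: ge0_le_integral => //.
  - by move=> w _; rewrite lee_fin.
  - exact/measurable_EFinP.
  - exact/measurable_EFinP.
  - by move=> w [Dw Bw]; rewrite lee_fin; exact: f12.
have g_ge0 w : 0 <= power_mono al N m n k.+1 w by exact: power_mono_ge0.
have condE (B : set nat) (Q : probability T R) (f : T -> R) :
    (forall f : T -> \bar R, measurable_fun (reach_all N) f ->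
      (forall w, reach_all N w -> 0 <= f w)%E ->
      (\int[P]_(w in reach_all N `&` [set w | B (N h w)]) f w =
       P [set w | B (N h w)] * \int[Q]_(w in reach_all N) f w)%E) ->
    (forall D, measurable_fun D f) -> (forall w, 0 <= f w) ->
    (\int[P]_(w in reach_all N `&` [set w | B (N h w)]) (f w)%:E =
       P [set w | B (N h w)] * \int[Q]_(w in reach_all N) (f w)%:E)%E.
  move=> cond mf f0; rewrite cond//; first exact/measurable_EFinP.
  by move=> w _; rewrite lee_fin.
have I0lo : ((p * v')%:E <= I [set 0%N])%E.
  rewrite EFinM -P0 -Ev' -(condE _ _ _ cond0)//.
  by apply: mono_int => // w Dw Nh; have /andP[] := ineq0 w Dw Nh.
have I0up : (I [set 0%N] <= (p * (v' + h ^+ 2 * K))%:E)%E.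
  apply: (@le_trans _ _ (p * (v' + h ^+ 2 * W0))%:E); last first.
    by rewrite lee_fin ler_wpM2l// lerD2l ler_wpM2l.
  rewrite EFinM EFinD (EFinM (h ^+ 2)) -P0 -Ev' -EW0 -ge0_integralDZ//.
  rewrite -(condE _ _ _ cond0); last 2 first.
  - by move=> D; apply: measurable_funD => //; exact: measurable_funM.
  - by move=> w; rewrite addr_ge0 ?(mulr_ge0 h2).
  apply: mono_int => // [D|w Dw Nh]; last by have /andP[] := ineq0 w Dw Nh.
  by apply: measurable_funD => //; exact: measurable_funM.
have q0 : 0 <= theta * h * p by rewrite !mulr_ge0 ?(ltW theta0).
have I1lo : ((theta * h * p * u)%:E <= I [set 1%N])%E.
  rewrite EFinM -P1 -momQ// -(condE _ _ _ cond1)//.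
  by apply: mono_int => // w Dw Nh; have /andP[] := ineq1 w Dw Nh.
have I1up : (I [set 1%N] <= (theta * h * p * (u + h * K))%:E)%E.
  apply: (@le_trans _ _ (theta * h * p * (u + h * W1))%:E); last first.
    by rewrite lee_fin ler_wpM2l// lerD2l ler_wpM2l.
  rewrite EFinM EFinD (EFinM h) -P1 -momQ// -EW1 -ge0_integralDZ//.
  rewrite -(condE _ _ _ cond1); last 2 first.
  - by move=> D; apply: measurable_funD => //; exact: measurable_funM.
  - by move=> w; rewrite addr_ge0 ?(mulr_ge0 h0').
  apply: mono_int => // [D|w Dw Nh]; last by have /andP[] := ineq1 w Dw Nh.
  by apply: measurable_funD => //; exact: measurable_funM.
have r0 : 0 <= 1 - (1 + theta * h) * p.
  by rewrite -lee_fin -P2 measure_ge0.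
have I2up : (I [set i | (1 < i)%N] <= ((1 - (1 + theta * h) * p) * K)%:E)%E.
  apply: (@le_trans _ _ ((1 - (1 + theta * h) * p) * W2)%:E); last first.
    by rewrite lee_fin ler_wpM2l.
  rewrite EFinM -P2 -EW2 -(condE _ _ _ cond2)//.
  by apply: mono_int => // w Dw _; exact: ineq2.
have I2lo : (0 <= I [set i | (1 < i)%N])%E.
  by apply: integral_ge0 => w _; rewrite lee_fin.
rewrite -2!lee_fin fineK ?moment_fin_num// (moment_split _ _ _ HN h0).
rewrite -/(I [set 0%N]) -/(I [set 1%N]) -/(I [set i | (1 < i)%N]).
apply/andP; split.
  by rewrite EFinD -[leLHS]adde0 leeD// leeD.
by rewrite !EFinD leeD// leeD.
Qed.

End one_step.

(** If [D] were positive, the loss [(1 - expR (- (theta * h))) * D] would be of order [h] and could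
    not be made up by [C * h ^+ 2] for small [h]. *)
Lemma contraction_le0 (R : realType) (theta C D : R) :
  0 < theta -> 0 <= C ->
  (forall h, 0 < h <= 1 -> D <= expR (- (theta * h)) * D + C * h ^+ 2) -> D <= 0.
Proof.
move=> theta0 C0 HD; rewrite leNgt; apply/negP => D0.
have tD : 0 < theta * D by exact: mulr_gt0.
pose B := C * (1 + theta).
have B0 : 0 <= B by rewrite mulr_ge0// addr_ge0// ltW.
have tDB : 0 < theta * D + B by rewrite ltr_pwDl.
(* Multiplying by [1 + theta * h <= 1 + theta] reduces the contradiction to [B * h < theta * D]. The
   summand [theta * D] in the denominator also forces [h <= 1]. *)
pose h := theta * D / (theta * D + B).
have h0 : 0 < h by rewrite divr_gt0.
have h1 : h <= 1 by rewrite ler_pdivrMr// mul1r lerDl.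
have hB : B * h < theta * D.
  by rewrite /h mulrA ltr_pdivrMr// mulrC ltr_pM2l// ltrDr.
have := HD h; rewrite h0 h1 => /(_ isT).
apply/negP; rewrite -ltNge.
set y := theta * h.
have y0 : 0 < y by exact: mulr_gt0.
have p1 : expR (- y) * (1 + y) <= 1.
  by rewrite mulrC -[leRHS](expRxMexpNx_1 y) ler_wpM2r ?expR_ge0// expR_ge1Dx.
have y1 : 0 < 1 + y by rewrite addr_gt0.
rewrite -(ltr_pM2r y1) mulrDl mulrAC.
apply: (@le_lt_trans _ _ (D + C * h ^+ 2 * (1 + y))).
  by rewrite lerD2r ler_piMl// ltW.
rewrite [ltRHS]mulrDr mulr1 ltrD2l.
apply: (@le_lt_trans _ _ (B * h * h)).
  rewrite (_ : B * h * h = C * h ^+ 2 * (1 + theta)); last by rewrite /B; ring.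
  have Ch0 : 0 <= C * h ^+ 2 by rewrite mulr_ge0 ?exprn_ge0 ?(ltW h0).
  rewrite (ler_wpM2l Ch0)// lerD2l.
  by rewrite /y ler_piMr// ltW.
by rewrite (_ : D * y = theta * D * h) ?ltr_pM2r//; rewrite /y; ring.
Qed.

(** * The recursion, from a supremum over all Poisson processes on the space *)

Section recursion.
Context (R : realType) (d : measure_display) (T : measurableType d).
Variables (theta al : R).
Hypotheses (theta0 : 0 < theta) (al0 : 0 < al).
Implicit Types (P : probability T R) (N : R -> T -> nat).

(** The lower moments are assumed equal for all processes and all probabilities, because the
    restarted process lives under another probability. The guards [0 < m] and [0 < n] leave [c2] or
    [c3] arbitrary when its coefficient is 0. *)
Lemma moment_recursion m n k (c1 c2 c3 : R) :
  (forall P N, poisson_process P theta N -> moment al P N m n k = c1%:E) ->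
  ((0 < m)%N -> forall P N, poisson_process P theta N ->
    moment al P N m.-1 n k.+1 = c2%:E) ->
  ((0 < n)%N -> forall P N, poisson_process P theta N ->
    moment al P N m n.-1 k.+1 = c3%:E) ->
  forall P N, poisson_process P theta N -> moment al P N m n k.+1 =
    (c1 + (m%:R * c2 + n%:R * (k%:R + al) * c3) / theta)%:E.
Proof.
move=> H1 H2 H3 P N HN.
set c := (X in X%:E).
set l := m%:R * c2 + n%:R * (k%:R + al) * c3 in c *.
have cE : theta * c = theta * c1 + l.
  by rewrite /c; field; rewrite lt0r_neq0.
have [K K0 HK] := moment_one_step T theta0 al0 m n k.
have [K1 K10 HK1] := moment_bound T theta0 al0 m n k.+1.
(* The pair of probability and process varies, so the supremum also controls the restarted process
   under [Q0]. It is finite by the uniform bound [moment_bound]. *)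
pose dist := [set `|fine (moment al QM.1 QM.2 m n k.+1) - c| |
  QM in [set QM : probability T R * (R -> T -> nat) |
    poisson_process QM.1 theta QM.2]].
have dist_ub : has_ubound dist.
  exists (K1 + `|c|) => _ [[Q M] /= HM <-].
  rewrite (le_trans (ler_normB _ _))// lerD2r ger0_norm ?fine_ge0 ?moment_ge0//.
  by rewrite -lee_fin fineK ?(moment_fin_num theta0 al0)// HK1.
pose D := sup dist.
have dist_le (Q : probability T R) (M : R -> T -> nat) : poisson_process Q theta M ->
    `|fine (moment al Q M m n k.+1) - c| <= D.
  by move=> HM; apply: ub_le_sup => //; exists (Q, M).
have dist0 : dist !=set0.
  by exists `|fine (moment al P N m n k.+1) - c|; exists (P, N).
(* The summands come from the no-jump remainder, the one-jump remainder, and the probability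
   [q <= (theta * h) ^+ 2] of several jumps multiplied by [K] and by [c]. *)
pose C := K + theta * K + theta ^+ 2 * (K + `|c|).
have D0 : D <= 0.
  apply: (@contraction_le0 _ theta C) => //.
    by rewrite /C !addr_ge0 ?mulr_ge0 ?exprn_ge0 ?addr_ge0 ?(ltW theta0).
  move=> h h01; apply: ge_sup => // _ [[Q M] /= HM <-].
  have [Q0 [Q1 [HQ0 HQ1]]] := HK Q M h HM h01.
  cbv zeta.
  rewrite (H1 _ _ HQ1)/=.
  have -> : m%:R * fine (moment al Q0 (shift_process h M) m.-1 n k.+1) +
     n%:R * (k%:R + al) * fine (moment al Q0 (shift_process h M) m n.-1 k.+1) = l.
    rewrite /l; congr (_ + _).
      by have [->|m0] := posnP m; rewrite ?mul0r// (H2 m0 _ _ HQ0).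
    by have [->|n0] := posnP n; rewrite ?mul0r// (H3 n0 _ _ HQ0).
  have := dist_le _ _ HQ0.
  set p := expR _; set v0 := fine (moment al Q0 _ _ _ _); set v := fine _.
  move=> v0D /andP[lo up].
  case/andP: h01 => h0 h1.
  set y := theta * h in p lo up *.
  have y0 : 0 < y by exact: mulr_gt0.
  have p0 : 0 <= p by exact: expR_ge0.
  have p1 : p <= 1 by rewrite -expR0 ler_expR oppr_le0 ltW.
  pose q := 1 - (1 + y) * p.
  have q0 : 0 <= q.
    by rewrite /q subr_ge0 -[leRHS](expRxMexpNx_1 y) ler_wpM2r// expR_ge1Dx.
  have q2 : q <= y ^+ 2.
    have := expR_ge1Dx (- y); rewrite -/p => /(ler_wpM2l (addr_ge0 ler01 (ltW y0))).
    rewrite /q; lra.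
  (* The relation [theta * c = theta * c1 + l] cancels all terms of order [h], leaving the
     contracted deviation and a multiple of [q]. *)
  have base : p * (v0 + h * l) + y * p * c1 - c = p * (v0 - c) - c * q.
    have -> : l = theta * c - theta * c1 by rewrite cE; ring.
    by rewrite /q /y; ring.
  have pv : `|p * (v0 - c)| <= p * D by rewrite normrM (ger0_norm p0) ler_wpM2l.
  have cq : `|c * q| <= `|c| * y ^+ 2 by rewrite normrM (ger0_norm q0) ler_wpM2l.
  have e1 : p * (h ^+ 2 * K) <= h ^+ 2 * K.
    by rewrite ler_piMl// mulr_ge0// exprn_ge0// ltW.
  have e2 : y * p * (h * K) <= theta * h ^+ 2 * K.
    rewrite (_ : y * p * (h * K) = p * (theta * h ^+ 2 * K)); last by rewrite /y; ring.
    by rewrite ler_piMl// !mulr_ge0 ?exprn_ge0 ?(ltW theta0) ?(ltW h0).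
  have e3 : q * K <= y ^+ 2 * K by exact: ler_wpM2r.
  have y2 : y ^+ 2 = theta ^+ 2 * h ^+ 2 by rewrite /y exprMn.
  move: pv cq; rewrite !ler_norml => /andP[pv1 pv2] /andP[cq1 cq2].
  have K3 : 0 <= h ^+ 2 * K by rewrite mulr_ge0 ?exprn_ge0 ?(ltW h0).
  have K4 : 0 <= theta * h ^+ 2 * K by rewrite !mulr_ge0 ?exprn_ge0 ?(ltW h0) ?(ltW theta0).
  have K5 : 0 <= y ^+ 2 * K by rewrite mulr_ge0 ?exprn_ge0 ?(ltW y0).
  have CE : C * h ^+ 2 = h ^+ 2 * K + theta * h ^+ 2 * K + y ^+ 2 * K + `|c| * y ^+ 2.
    by rewrite /C y2; ring.
  rewrite CE; apply/andP; split.
    lra.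
  have -> : v - c = (v - (p * (v0 + h * l) + y * p * c1)) + (p * (v0 - c) - c * q).
    by rewrite -base; ring.
  have vup : v - (p * (v0 + h * l) + y * p * c1) <=
      p * (h ^+ 2 * K) + y * p * (h * K) + q * K.
    rewrite lerBlDl (le_trans up)// le_eqVlt; apply/orP; left; apply/eqP.
    by rewrite /q; ring.
  lra.
have := le_trans (dist_le P N HN) D0; rewrite normr_le0 subr_eq0 => /eqP <-.
by rewrite fineK// (moment_fin_num theta0 al0 m n k.+1 HN).
Qed.

End recursion.

(** * Existence of the common values, and the link with [joint_moment] *)

Section values.
Context (R : realType) (d : measure_display) (T : measurableType d).
Variables (theta al : R).
Hypotheses (theta0 : 0 < theta) (al0 : 0 < al) (al1 : al <= 1).
Implicit Types (P : probability T R) (N : R -> T -> nat).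

(** At index 0 both duration and area vanish, and [reach_all] has probability 1. The convention that
    [0 ^+ 0] is 1 gives the value 1 for [m = n = 0]. *)
Lemma moment0 P N m n : poisson_process P theta N ->
  moment al P N m n 0 = (0 ^+ m * 0 ^+ n)%:E.
Proof.
move=> HN; have mD := measurable_reach_all HN.
transitivity (\int[P]_(w in reach_all N) cst (0 ^+ m * 0 ^+ n)%:E w)%E.
  apply: eq_integral => w _.
  by rewrite /power_mono /area_sum big_ord0 arrival0 mulr0 addr0.
have PD : P (reach_all N) = 1%E.
  rewrite -[reach_all N]classical_sets.setCK probability_setC ?measurableC//.
    by rewrite (poisson_not_reach_all theta0 HN) sube0.
  exact: measurableC.
rewrite integral_cst//; exact: (eq_trans (congr1 (mule _) PD) (mule1 _)).
Qed.

Lemma moment_invariant k m n : exists c : R,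
  forall P N, poisson_process P theta N -> moment al P N m n k = c%:E.
Proof.
elim: k m n => [|k IHk] m n.
  by exists (0 ^+ m * 0 ^+ n) => P N; exact: moment0.
(* For fixed [k], an inner induction on a bound of [m + n]: the recursion calls index [k], or index
   [k.+1] with [m] or [n] lowered by one. *)
have [s smn] : exists s, (m + n <= s)%N by exists (m + n)%N.
elim: s m n smn => [|s IHs] m n smn.
  have [c1 H1] := IHk m n; exists (c1 + (m%:R * 0 + n%:R * (k%:R + al) * 0) / theta).
  move: smn; rewrite leqn0 addn_eq0 => /andP[/eqP m0 /eqP n0].
  by apply: moment_recursion => //; rewrite ?m0 ?n0.
have [c1 H1] := IHk m n.
have [c2 H2] : exists c2 : R, (0 < m)%N -> forall P N, poisson_process P theta N ->
    moment al P N m.-1 n k.+1 = c2%:E.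
  have [->|m0] := posnP m; first by exists 0.
  have [|c2 H2] := IHs m.-1 n; last by exists c2.
  by rewrite -ltnS (leq_trans _ smn)// -addSn prednK.
have [c3 H3] : exists c3 : R, (0 < n)%N -> forall P N, poisson_process P theta N ->
    moment al P N m n.-1 k.+1 = c3%:E.
  have [->|n0] := posnP n; first by exists 0.
  have [|c3 H3] := IHs m n.-1; last by exists c3.
  by rewrite -ltnS (leq_trans _ smn)// -addnS prednK.
exists (c1 + (m%:R * c2 + n%:R * (k%:R + al) * c3) / theta).
exact: moment_recursion.
Qed.

Lemma moment_recursionE P N m n k : poisson_process P theta N ->
  fine (moment al P N m n k.+1) = fine (moment al P N m n k) +
  (m%:R * fine (moment al P N m.-1 n k.+1) +
   n%:R * (k%:R + al) * fine (moment al P N m n.-1 k.+1)) / theta.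
Proof.
move=> HN.
have [c1 H1] := moment_invariant k m n.
have [c2 H2] := moment_invariant k.+1 m.-1 n.
have [c3 H3] := moment_invariant k.+1 m n.-1.
rewrite (moment_recursion theta0 al0 H1 (fun=> H2) (fun=> H3) HN).
by rewrite (H1 _ _ HN) (H2 _ _ HN) (H3 _ _ HN).
Qed.

Lemma measurable_expe (f : T -> \bar R) n : measurable_fun setT f ->
  measurable_fun setT (fun w => (f w ^+ n)%E).
Proof.
move=> mf; elim: n => [|n IHn].
  by under eq_fun do rewrite expe0; exact: measurable_cst.
by under eq_fun do rewrite expeS; exact: emeasurable_funM.
Qed.

(** Off the null complement of [reach_all] all passage times are finite, and the layer formula turns
    the extended integrand into the real one. *)
Lemma joint_momentE P N m n k : poisson_process P theta N ->
  joint_moment N P m n (k%:R + al) = moment al P N m n k.+1.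
Proof.
move=> HN; have mD := measurable_reach_all HN.
rewrite /joint_moment (@ge0_negligible_integral _ _ _ P setT (~` reach_all N)) //.
- rewrite (_ : setT `\` _ = reach_all N); last first.
    by rewrite classical_sets.setDE classical_sets.setCK classical_sets.setTI.
  apply: eq_integral => w; rewrite inE => Dw.
  rewrite (passage_area_sum HN)// passage_time_ceil// -(EFin_arrival HN)//.
  under eq_bigr do rewrite -(EFin_arrival HN)//.
  by rewrite sumEFin -EFinM -EFinD -area_sumS -!EFin_expe -EFinM.
- exact: measurableC.
- apply: emeasurable_funM; apply: measurable_expe.
    exact: (measurable_passage_time HN).
  have -> := funext (fun w => passage_area_sum HN k w al0 al1).
  apply: emeasurable_funD.
    by apply: emeasurable_sum => i; exact: (measurable_passage_time HN).
  by apply: emeasurable_funM => //; exact: (measurable_passage_time HN).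
- move=> w _; rewrite mule_ge0// expe_ge0 ?passage_time_ge0//.
  rewrite (passage_area_sum HN)// adde_ge0//.
    by apply: sume_ge0 => i _; exact: passage_time_ge0.
  by rewrite mule_ge0 ?passage_time_ge0// lee_fin ltW.
- exact: (poisson_not_reach_all theta0 HN).
Qed.

Lemma joint_moment_le0 P N m n y : (m, n) <> (0%N, 0%N) -> y <= 0 ->
  joint_moment N P m n y = 0%E.
Proof.
move=> mn y0; rewrite /joint_moment; apply: integral0_eq => w _.
rewrite /passage_time /passage_area y0.
case: m n mn => [|m] [|n] // _; rewrite ?expeS ?mul0e ?mule0//.
Qed.

(** For [k = 0] the argument [al - 1] is nonpositive and both sides are 0, as [(m, n)] is
    nonzero. *)
Lemma joint_momentB1 P N m n k : poisson_process P theta N ->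
  (m, n) <> (0%N, 0%N) ->
  joint_moment N P m n (k%:R + al - 1) = moment al P N m n k.
Proof.
move=> HN mn; case: k => [|k]; last first.
  rewrite (_ : k.+1%:R + al - 1 = k%:R + al); last by rewrite -natr1; ring.
  exact: joint_momentE.
rewrite joint_moment_le0//; last by rewrite add0r subr_le0.
rewrite (moment0 m n HN); case: m n mn => [|m] [|n] // _;
  by rewrite ?exprS ?mul0r ?mulr0.
Qed.

End values.

(** The fraction is taken in []0, 1]], so that [k.+1] is the least natural number at or above [x],
    the number of jumps to passage. *)
Lemma nat_add_fraction (R : realType) (x : R) : 0 < x ->
  exists k : nat, exists al : R, [/\ 0 < al, al <= 1 & x = k%:R + al].
Proof.
move=> x0.
have ex : exists n : nat, x <= n%:R.
  by exists (Num.bound x); exact/ltW/archi_boundP/ltW.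
case: (ex_minnP ex) => -[|k] xk kmin.
  by move: xk; rewrite leNgt x0.
exists k, (x - k%:R); split; last by rewrite addrC subrK.
  by rewrite subr_gt0 ltNge; apply/negP => /kmin; rewrite ltnn.
by rewrite lerBlDl natr1.
Qed.

Unset Implicit Arguments.

(** * Decay as the intensity grows *)

Section limit.
Context (R : realType) (al : R) (al0 : 0 < al).
Variables (d : R -> measure_display)
    (T : forall theta : R, measurableType (d theta))
    (P : forall theta : R, probability (T theta) R)
    (N : forall theta : R, R -> T theta -> nat).
Hypothesis HN : forall theta : R, 0 < theta ->
  poisson_process (P theta) theta (N theta).

Let f theta m n k := fine (moment al (P theta) (N theta) m n k).

Let f0 theta m n k : 0 <= f theta m n k.
Proof. by rewrite fine_ge0// moment_ge0. Qed.

(** Boundedness and decay like [C / theta] are proved together. In the recursion the lower order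
    terms carry a factor [1 / theta], so boundedness suffices for them, even for the moment of order
    [(0, 0)]; the term of index [k] needs the decay itself. *)
Lemma moment_decay k m n : exists2 C : R, 0 <= C &
  forall theta, 1 <= theta ->
    f theta m n k <= C /\ ((m, n) <> (0%N, 0%N) -> theta * f theta m n k <= C).
Proof.
elim: k m n => [|k IHk] m n.
  exists 1 => // theta t1; have t0 : 0 < theta by exact: lt_le_trans t1.
  rewrite /f (moment0 al t0 m n (HN theta t0))/=; case: m n => [|m] [|n];
    by rewrite ?exprS ?expr0 ?mul0r ?mulr0 ?mulr1.
have [s smn] : exists s, (m + n <= s)%N by exists (m + n)%N.
elim: s m n smn => [|s IHs] m n smn.
  have [C C0 HC] := IHk m n; exists C => // theta t1.
  have t0 : 0 < theta by exact: lt_le_trans t1.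
  move: smn; rewrite leqn0 addn_eq0 => /andP[/eqP m0 /eqP n0].
  split; last by rewrite m0 n0.
  rewrite /f (moment_recursionE t0 al0 _ _ _ (HN theta t0)) m0 n0 !mul0r addr0 mul0r addr0.
  by have [] := HC theta t1; rewrite m0 n0.
have [C1 C10 H1] := IHk m n.
have [C2 C20 H2] : exists2 C : R, 0 <= C & forall theta, 1 <= theta ->
    m%:R * f theta m.-1 n k.+1 <= C.
  have [->|m0] := posnP m; first by exists 0 => // theta _; rewrite mul0r.
  have [|C C0 HC] := IHs m.-1 n.
    by rewrite -ltnS (leq_trans _ smn)// -addSn prednK.
  exists (m%:R * C); first exact: mulr_ge0.
  by move=> theta /HC[HC1 _]; rewrite ler_wpM2l.
have [C3 C30 H3] : exists2 C : R, 0 <= C & forall theta, 1 <= theta ->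
    n%:R * f theta m n.-1 k.+1 <= C.
  have [->|n0] := posnP n; first by exists 0 => // theta _; rewrite mul0r.
  have [|C C0 HC] := IHs m n.-1.
    by rewrite -ltnS (leq_trans _ smn)// -addnS prednK.
  exists (n%:R * C); first exact: mulr_ge0.
  by move=> theta /HC[HC1 _]; rewrite ler_wpM2l.
pose x := k%:R + al.
have x0 : 0 <= x by rewrite addr_ge0 ?(ltW al0).
exists (C1 + (C2 + x * C3)); first by rewrite !addr_ge0 ?mulr_ge0.
move=> theta t1; have t0 : 0 < theta by exact: lt_le_trans t1.
have [H1a H1b] := H1 theta t1.
have L0 : m%:R * f theta m.-1 n k.+1 + n%:R * x * f theta m n.-1 k.+1 <= C2 + x * C3.
  rewrite lerD ?H2// mulrAC mulrC ler_wpM2l// H3//.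
have E : f theta m n k.+1 = f theta m n k +
    (m%:R * f theta m.-1 n k.+1 + n%:R * x * f theta m n.-1 k.+1) / theta.
  exact: (moment_recursionE t0 al0 m n k (HN theta t0)).
rewrite E; split.
  rewrite lerD// ler_pdivrMr//; apply: (le_trans L0).
  by rewrite ler_peMr// addr_ge0 ?mulr_ge0.
by move=> mn; rewrite mulrDr lerD ?H1b// mulrC divfK ?lt0r_neq0.
Qed.

End limit.

(** * The boundary value problem and the limit *)

Theorem theorem3p2 (R : realType) (d : R -> measure_display)
    (T : forall theta : R, measurableType (d theta))
    (P : forall theta : R, probability (T theta) R)
    (N : forall theta : R, R -> T theta -> nat)
    (HN : forall theta : R, 0 < theta ->
            poisson_process (P theta) theta (N theta))
    (m n : nat) (Hmn : (m, n) <> (0%N, 0%N)) :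
  let V := fun (theta : R) (i j : nat) (x : R) =>
             joint_moment (N theta) (P theta) i j x in
  [/\ (forall theta x : R, 0 < theta -> V theta m n x \is a fin_num),
      (forall theta x : R, 0 < theta -> 0 < x ->
         (theta%:E * (V theta m n (x - 1)%R - V theta m n x) =
          - (n%:R * x)%:E * V theta m n.-1 x
          - m%:R%:E * V theta m.-1 n x)%E),
      (forall theta y : R, 0 < theta -> y <= 0 -> V theta m n y = 0%E) &
      (forall x : R, V theta m n x @[theta --> +oo] --> 0%E)].
Proof.
move=> V.
have V_le0 theta y : y <= 0 -> V theta m n y = 0%E by exact: joint_moment_le0.
split.
- move=> theta x t0; have [x0|x0] := leP x 0; first by rewrite V_le0.
  have [k [al [al0 al1 ->]]] := nat_add_fraction x0.
  rewrite /V (joint_momentE t0 al0 al1 m n k (HN _ t0)).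
  exact: (moment_fin_num t0 al0 m n k.+1 (HN _ t0)).
- move=> theta x t0 x0; have [k [al [al0 al1 ->]]] := nat_add_fraction x0.
  have HNt := HN _ t0.
  rewrite /V (joint_momentB1 t0 al0 al1 k HNt Hmn) !(joint_momentE t0 al0 al1 _ _ k HNt).
  have F i j l := fineK (moment_fin_num t0 al0 i j l HNt).
  rewrite -(F m n k) -(F m n k.+1) -(F m n.-1 k.+1) -(F m.-1 n k.+1).
  rewrite -!EFinN -!EFinD -!EFinM -?EFinN -?EFinD; congr EFin.
  rewrite (moment_recursionE t0 al0 m n k HNt).
  by field; rewrite lt0r_neq0.
- by move=> theta y _; exact: V_le0.
(* For [x <= 0] the moment is 0 at every [theta]; for [x > 0] it is squeezed between 0 and
   [C / theta] once [theta >= 1]. *)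
- move=> x; have [x0|x0] := leP x 0.
    rewrite (_ : (fun theta => V theta m n x) = cst 0%E); first exact: cvg_cst.
    by apply/funext => theta; exact: V_le0.
  have [k [al [al0 al1 ->]]] := nat_add_fraction x0.
  have [C C0 HC] := moment_decay _ _ al0 _ _ _ _ HN k.+1 m n.
  apply: (@squeeze_cvge _ _ _ _ (cst 0%E) _ (fun theta => (C / theta)%:E)).
  + near=> theta.
    have t1 : 1 <= theta by near: theta; apply: nbhs_pinfty_ge; exact: num_real.
    have t0 : 0 < theta by exact: lt_le_trans t1.
    have [_ /(_ Hmn) Ct] := HC theta t1.
    rewrite /V (joint_momentE t0 al0 al1 m n k (HN _ t0)) /= moment_ge0//=.
    rewrite -(fineK (moment_fin_num t0 al0 m n k.+1 (HN _ t0))) lee_fin.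
    by rewrite ler_pdivlMr// mulrC.
  + exact: cvg_cst.
  + apply: cvg_EFin; first exact: nearW.
    apply/cvgrPdist_le => e e0; near=> theta.
    have t0 : 0 < theta by near: theta; apply: nbhs_pinfty_gt; exact: num_real.
    rewrite /= sub0r normrN ger0_norm ?divr_ge0 ?(ltW t0)//.
    by rewrite ler_pdivrMr// mulrC -ler_pdivrMr//; near: theta;
      apply: nbhs_pinfty_ge; exact: num_real.
Unshelve. all: by end_near.
Qed.
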